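(* Fix any integer $N\ge 2$ and any $\gamma\in(0,\pi/2)$, and let all natural frequencies be zero. (KRW) For any $\epsilon>0$ and any initial condition $\boldsymbol{\theta}^\epsilon_0\in\Delta(\gamma)\subset\mathbb{T}^N$, the solution $\boldsymbol{\theta}^\epsilon(t)$ of the Kuramoto Random Walk system with $\boldsymbol\omega=\mathbf 0$ converges $\mathbb{P}$-almost surely to $\mathbf 0$ (up to a global translation) as $t\to\infty$. (DRC) For any $\epsilon,\kappa>0$ and any initial condition $\boldsymbol{\theta}^{\epsilon,\kappa}_0\in\Delta(\gamma)\subset\mathbb{T}^{|V|}$, the solution $\boldsymbol{\theta}^{\epsilon,\kappa}(t)$ of the Kuramoto model on the Dynamic Random Conductance Model with $\boldsymbol\omega=\mathbf 0$ converges $\mathbb{P}$-almost surely to $\mathbf 0$ (up to a global translation) as $t\to\infty$.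
   Context: Skeleton. $\mathbb{G}=(V,E)$ is a finite connected graph with symmetric weights $\pi(u,v)=\pi(v,u)\in[0,\infty)$ for $u,v\in V$; the edges are the (unordered) pairs $\{u,v\}$ (possibly $u=v$) with $\pi(u,v)>0$. Put $\pi(u)=\sum_{v\in V}\pi(u,v)>0$. $K>0$ is a constant. $\mathbb{T}^n=(\mathbb{R}/2\pi\mathbb{Z})^n$. Kuramoto Random Walk (KRW). Assume in addition that every vertex has a self-loop: $\pi(u,u)>0$ for all $u\in V$. For $\epsilon\in(0,\infty)$, $\mathbf X^\epsilon(t)=(X^\epsilon_1(t),\dots,X^\epsilon_N(t))$ consists of $N$ independent continuous-time random walks on $\mathbb{G}$: each walk jumps at constant rate $\epsilon^{-1}$, and from $u$ it jumps to $v$ with probability $\pi(u,v)/\pi(u)$. The starting point $\mathbf X^\epsilon(0)=\mathbf x^\epsilon_0\in V^N$ is given. For $\mathbf x=(x_1,\dots,x_N)\in V^N$ let $a_{ij}(\mathbf x)=\pi(x_i,x_j)$. With natural frequencies $\boldsymbol\omega=(\omega_i)_{i=1}^N$, the KRW system for $\boldsymbol\theta^\epsilon(t)\in\mathbb{T}^N$ is $$\frac{d}{dt}\theta^\epsilon_i(t)=\omega_i+\frac{K}{N}\sum_{j=1}^N a_{ij}(\mathbf X^\epsilon(t))\sin\big(\theta^\epsilon_j(t)-\theta^\epsilon_i(t)\big),\quad i=1,\dots,N,\ t\ge0,\qquad \boldsymbol\theta^\epsilon(0)=\boldsymbol\theta^\epsilon_0.$$ Kuramoto model on the Dynamic Random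 Conductance Model (DRC). For $\epsilon,\kappa>0$, each edge $e\in E$ carries an independent continuous-time Markov chain $(e^{\epsilon,\kappa}(t))_{t\ge0}$ on $\{0,1\}$, which jumps from $1$ to $0$ at rate $\epsilon^{-1}$ and from $0$ to $1$ at rate $\kappa$, started at $e^{\epsilon,\kappa}(0)=1$. Let $\mathcal{E}^{\epsilon,\kappa}(t)=\{e\in E: e^{\epsilon,\kappa}(t)=1\}$, and for $\mathcal{E}\subset E$ let $a_{uv}(\mathcal{E})=1_{\{\{u,v\}\in\mathcal{E}\}}\,\pi(u,v)$. With natural frequencies $\boldsymbol\omega=(\omega_u)_{u\in V}$, the system for $\boldsymbol\theta^{\epsilon,\kappa}(t)\in\mathbb{T}^{|V|}$ is $$\frac{d}{dt}\theta^{\epsilon,\kappa}_u(t)=\omega_u+\frac{K}{|V|}\sum_{v\in V}a_{uv}(\mathcal{E}^{\epsilon,\kappa}(t))\sin\big(\theta^{\epsilon,\kappa}_v(t)-\theta^{\epsilon,\kappa}_u(t)\big),\quad u\in V,\ t>0,\qquad \boldsymbol\theta^{\epsilon,\kappa}(0)=\boldsymbol\theta^{\epsilon,\kappa}_0.$$ For every realization of the randomness solutions are understood in the Carathéodory sense; they exist and are unique. Phase-cohesive set: $\Delta(\gamma)=\{\boldsymbol\theta:\max_{i,j}|\theta_i-\theta_j|\le\gamma\}$, where for $\theta_i,\theta_j\in\mathbb{T}$, $|\theta_i-\theta_j|\in[0,\pi]$ denotes geodesic distance on the circle. ''$\boldsymbol\theta(t)$ converges to $\mathbf 0$ up to a global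 translation'' means that there is $c\in\mathbb{T}$ such that every component of $\boldsymbol\theta(t)$ converges to $c$ as $t\to\infty$. *)

(* Defs.v *)
From HB Require Import structures.
From mathcomp Require Import all_boot all_order all_algebra generic_quotient.
From mathcomp Require Import all_classical all_reals all_analysis.

Set Implicit Arguments.
Unset Strict Implicit.
Unset Printing Implicit Defensive.

Import Order.TTheory GRing.Theory Num.Theory.
Import numFieldNormedType.Exports.

Local Open Scope classical_set_scope.
Local Open Scope ring_scope.

Section Circle.
Variable R : realType.

Definition circle_rel (x y : R) : bool := (x - y) / (2 * pi) \is a Num.int.

Lemma circle_rel_refl : reflexive circle_rel.
Proof. by move=> x; rewrite /circle_rel subrr mul0r. Qed.

Lemma circle_rel_sym : symmetric circle_rel.
Proof. by move=> x y; rewrite /circle_rel -(opprB x y) mulNr rpredN. Qed.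

Lemma circle_rel_trans : transitive circle_rel.
Proof.
move=> y x z xy yz.
have -> : circle_rel x z = ((x - y) / (2 * pi) + (y - z) / (2 * pi) \is a Num.int).
  by rewrite -mulrDl addrA subrK.
exact: rpredD.
Qed.

Canonical circle_equiv :=
  EquivRel circle_rel circle_rel_refl circle_rel_sym circle_rel_trans.

(* R / 2 pi Z *)
Definition circle := {eq_quot circle_equiv}%qT.

Definition to_circle (x : R) : circle := (\pi_circle x)%qT.

Lemma to_circleP (x y : R) :
  (to_circle x = to_circle y) <-> exists k : int, x = y + k%:~R * (2 * pi).
Proof.
have p2 : 2 * pi != 0 :> R by rewrite mulf_neq0 ?pnatr_eq0 ?gt_eqF ?pi_gt0.
split=> [/eqmodP /intrP[k kE]|[k ->]].
  by exists k; rewrite -kE divfK // addrC subrK.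
by apply/eqmodP; rewrite /= /circle_rel addrC addKr mulfK.
Qed.

Definition geodist (x y : circle) : R :=
  inf [set r | exists a b : R,
    [/\ to_circle a = x, to_circle b = y & r = `|a - b|]].

Definition phase_cohesive (I : finType) (gamma : R) : set (I -> circle) :=
  [set theta | forall i j, geodist (theta i) (theta j) <= gamma].

Definition converges_up_to_translation (I : finType)
    (theta : R -> I -> circle) : Prop :=
  exists c : circle, forall i, geodist (theta t i) c @[t --> +oo] --> 0.

End Circle.

Section Kuramoto.
Variable R : realType.

Definition absolutely_continuous_on (a b : R) (f : R -> R) : Prop :=
  forall e, 0 < e -> exists2 d, 0 < d & forall s : seq (R * R),
    (forall p, p \in s -> [/\ a <= p.1, p.1 <= p.2 & p.2 <= b]) ->
    pairwise (fun p q => (p.2 <= q.1) || (q.2 <= p.1)) s ->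
    \sum_(p <- s) (p.2 - p.1) < d ->
    \sum_(p <- s) `|f p.2 - f p.1| < e.

(* The vector field is 2 pi-periodic in every coordinate, so it may be
   evaluated at any representatives of the phases. *)
Definition kuramoto_field (I : finType) (K : R) (omega : I -> R)
    (a : I -> I -> R) (x : I -> R) (i : I) : R :=
  omega i + K / #|I|%:R * \sum_j a i j * sin (x j - x i).

(* A Caratheodory solution on [0, +oo[ of the Kuramoto system with
   time-dependent coupling a : a curve in the torus is locally absolutely
   continuous iff it has a lift phi to R^I which is, and the equation then
   holds for almost every time. *)
Definition kuramoto_solution (I : finType) (K : R) (omega : I -> R)
    (a : R -> I -> I -> R) (theta : R -> I -> circle R) : Prop :=
  exists phi : R -> I -> R,
    [/\ forall t i, 0 <= t -> to_circle (phi t i) = theta t i,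
        forall T i, 0 < T -> absolutely_continuous_on 0 T (phi ^~ i : R -> R)
      & {ae (@lebesgue_measure R), forall t : R, 0 < t -> forall i,
          is_derive t (1 : R) (phi ^~ i : R -> R)
            (kuramoto_field K omega (a t) (phi t) i)}].

End Kuramoto.

Section Processes.
Variables (R : realType) (d : measure_display) (Omega : measurableType d).
Variable P : probability Omega R.

Definition transition_function (S : finType) (p : R -> S -> S -> R) : Prop :=
  [/\ forall t x y, 0 <= t -> 0 <= p t x y,
      forall t x, 0 <= t -> \sum_y p t x y = 1,
      forall x y, p 0 x y = (x == y)%:R
    & forall s t x z, 0 <= s -> 0 <= t ->
        p (s + t) x z = \sum_y p s x y * p t y z].

(* The values q x x are irrelevant: a jump from x to x is not a change of
   state. *)
Definition has_jump_rates (S : finType) (p : R -> S -> S -> R)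
    (q : S -> S -> R) : Prop :=
  forall x y, x != y -> p h x y / h @[h --> 0^'+] --> q x y.

(* For a discrete state space: right-continuous with left limits. *)
Definition cadlag_path (S : finType) (f : R -> S) : Prop :=
  (forall t, 0 <= t -> \forall s \near t^'+, f s = f t) /\
  (forall t, 0 < t -> exists x, \forall s \near t^'-, f s = x).

Definition markov_property (S : finType) (X : R -> Omega -> S)
    (p : R -> S -> S -> R) : Prop :=
  forall (past : seq (R * S)) (t h : R) (x y : S),
    0 <= t -> 0 <= h -> (forall r, r \in past -> 0 <= r.1 <= t) ->
    let H := [set w | forall r, r \in past -> X r.1 w = r.2] in
    P (H `&` [set w | X t w = x] `&` [set w | X (t + h) w = y]) =
    (P (H `&` [set w | X t w = x]) * (p h x y)%:E)%E.

(* X is a continuous-time Markov chain (restricted to times t >= 0) started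
   at x0 which jumps from x to y != x at rate q x y. *)
Definition markov_chain (S : finType) (q : S -> S -> R) (x0 : S)
    (X : R -> Omega -> S) : Prop :=
  [/\ forall t x, 0 <= t -> measurable [set w | X t w = x],
      forall w, cadlag_path (X ^~ w),
      forall w, X 0 w = x0
    & exists p, [/\ transition_function p, has_jump_rates p q
                  & markov_property X p]].

Definition process_sigma_algebra (S : finType) (X : R -> Omega -> S) :
    set (set Omega) :=
  <<s [set A | exists t x, 0 <= t /\ A = [set w | X t w = x]] >>.

(* Since the A i may be setT, the product rule over the whole finite index
   type I includes the one over its subfamilies. *)
Definition independent_processes (I S : finType)
    (X : I -> R -> Omega -> S) : Prop :=
  forall A : I -> set Omega,
    (forall i, process_sigma_algebra (X i) (A i)) ->
    P (\bigcap_i A i) = (\prod_i P (A i))%E.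

End Processes.

Section Skeleton.
Variables (R : realType) (V : finType).

Record weighted_graph := WeightedGraph {
  weight :> V -> V -> R;
  weight_sym : forall u v, weight u v = weight v u;
  weight_ge0 : forall u v, 0 <= weight u v;
  weight_connected : forall u v, connect (fun x y => 0 < weight x y) u v;
  weight_sum_gt0 : forall u, 0 < \sum_v weight u v
}.

Variable G : weighted_graph.

Definition degree (u : V) : R := \sum_v G u v.

(* The unordered pair {u, v} is the set [set u; v]; a self-loop is a
   singleton. *)
Definition edges : {set {set V}} :=
  [set e | [exists u, exists v, (e == [set u; v]%SET) && (0 < G u v)]]%SET.

Definition edge : finType := {e : {set V} | e \in edges}.

Definition walk_rate (eps : R) (u v : V) : R := eps^-1 * (G u v / degree u).

Definition walk_coupling (N : nat) (x : 'I_N -> V) (i j : 'I_N) : R :=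
  G (x i) (x j).

Definition conductance_rate (eps kappa : R) (b b' : bool) : R :=
  if b then eps^-1 else kappa.

Definition open_edges (y : edge -> bool) : {set {set V}} :=
  [set val e | e in [pred e | y e]]%SET.

Definition edge_coupling (E : {set {set V}}) (u v : V) : R :=
  if [set u; v]%SET \in E then G u v else 0.

End Skeleton.

(* Main.v *)
(** For phases in a ball of radius less than [pi / 2] the sums
    [\sum_i (theta_i - c) ^+ q.+1], [q] odd, decrease along the flow because the
    coupling is symmetric and nonnegative; letting [q] grow, the phases never
    leave a slightly larger ball. The mean phase is conserved, and while the
    coupling equals a fixed connected one, the variance decreases at an
    exponential rate. By irreducibility and independence, almost surely the
    environment is infinitely often in a favourable state (all walkers at one
    vertex, or all edges open) during a whole time window of fixed length, so
    that the variance tends to zero. *)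

Require Import Defs.
From mathcomp Require Import all_boot all_order all_algebra.
From mathcomp Require Import all_classical all_reals all_analysis.
From mathcomp Require Import ring lra.
Import Order.TTheory GRing.Theory Num.Theory.
Import numFieldNormedType.Exports.
Local Open Scope classical_set_scope.
Local Open Scope ring_scope.

Set Implicit Arguments.
Unset Strict Implicit.
Unset Printing Implicit Defensive.

(** * Absolutely continuous functions *)

(** The largest distance of a phase to [c] is not differentiable and the equation holds only almost
    everywhere, so smooth power sums stand in for it. Their monotonicity requires phase differences
    of at most [pi], which is part of what is to be proved; a bootstrap whose time step depends only
    on a Lipschitz constant of the phases removes this circularity. The Markov property is given at
    finitely many deterministic times only, so no hitting times are used. Time is cut into periods
    of length [2 * h], and in each of them the probability of a good window is bounded below
    whatever the past. A window is tested on dyadic grids, with a bound independent of the mesh, and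
    right-continuity fills in the other times. Independent chains are treated as one chain on the
    finite product space. Its transition function is a product of factors that are positive at every
    positive time, so all components reach their targets simultaneously, without any parity
    obstruction. *)

Lemma ae_imp (d : measure_display) (T : semiRingOfSetsType d) (R : realFieldType)
    (mu : set T -> \bar R) (P Q : T -> Prop) :
  (forall x, P x -> Q x) -> {ae mu, forall x, P x} -> {ae mu, forall x, Q x}.
Proof.
move=> PQ [N [mN N0 PN]]; exists N; split=> // x nQ; apply: PN => Px.
by apply: nQ; exact: PQ.
Qed.

Section RealAnalysis.
Variable R : realType.
Implicit Types (f g : R -> R) (a b t : R).

(** At the supremum of the points where [Q] holds, the step leads from a point just below to a point
    beyond, unless [b] is reached. The step jumps across [t] from [s] to [s'], so that [Q t] itself
    is never asked for. *)
Lemma real_induction (Q : R -> Prop) a b : a <= b -> Q a ->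
  (forall t, a <= t <= b -> exists2 e, 0 < e & forall s s',
     a <= s -> s <= t -> t <= s' -> s' <= b -> t - s < e -> s' - t < e ->
     Q s -> Q s') ->
  Q b.
Proof.
move=> ab Qa step; set S := [set t | a <= t <= b /\ Q t].
have Sa : S a by split=> //; rewrite lexx.
have supS : has_sup S by split; [exists a | exists b => t [/andP[]]].
have acb : a <= sup S <= b.
  by rewrite ub_le_sup //=; [apply: ge_sup; [exists a | move=> t [/andP[]]]
    | case: supS].
have [e e0 H] := step _ acb.
have [s [/andP[as_ sb] Qs] es] := sup_adherent e0 supS.
have sS : s <= sup S by apply: ub_le_sup; [case: supS | split; [rewrite as_|]].
have e2 : e / 2 < e by rewrite ltr_pdivrMr // ltr_pMr // ltr1n.
have e20 : 0 < e / 2 by rewrite divr_gt0.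
case/andP: acb => ac cb.
have [bc|cb'] := leP b (sup S + e / 2).
  apply: (H s) => //; first by lra.
  lra.
have Q' : Q (sup S + e / 2) by apply: (H s) => //; lra.
have : sup S + e / 2 <= sup S.
  by apply: ub_le_sup; [case: supS | split=> //; apply/andP; split; lra].
lra.
Qed.

Lemma is_derive_local_bound f t df e : is_derive t 1 f df -> 0 < e ->
  exists2 r, 0 < r & forall s, `|s - t| < r ->
    `|f s - f t - df * (s - t)| <= e * `|s - t|.
Proof.
move=> /is_derive1_caratheodory [g [fg gc <-]] e0.
have /cvgrPdist_le /(_ _ e0) /nbhs_ballP[r /= r0 H] := gc.
exists r => // s sr; rewrite fg -mulrBl normrM ler_wpM2r // distrC.
by apply: H; rewrite /ball /= distrC.
Qed.

Lemma pairwise_disj_rcons (s : seq (R * R)) (q : R * R) t :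
  (forall p, p \in s -> p.2 <= t) -> t <= q.1 ->
  pairwise (fun p q => (p.2 <= q.1) || (q.2 <= p.1)) s ->
  pairwise (fun p q => (p.2 <= q.1) || (q.2 <= p.1)) (rcons s q).
Proof.
move=> st tq ps; rewrite pairwise_rcons ps andbT; apply/allP => p /st pt.
by rewrite (le_trans pt tq).
Qed.

Local Notation lam := (@lebesgue_measure R).

(* Real induction along [a, b]: near a point of differentiability the derivative
   controls the increment, and the exceptional points lie in an open set of
   small measure, on which absolute continuity controls the total variation. *)
Lemma ac_increment_le f a b (C : R) : 0 <= C -> a <= b ->
  absolutely_continuous_on a b f ->
  {ae lam, forall t, a < t -> t < b ->
     exists2 df, is_derive t 1 f df & df <= C} ->
  f b - f a <= C * (b - a).
Proof.
move=> C0 ab acf [N [mN N0 HN]].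
suff H e : 0 < e -> f b - f a <= (C + e) * (b - a) + e.
  apply/ler_addgt0Pl => e e0.
  have k0 : 0 < b - a + 1 by lra.
  have := H (e / (b - a + 1)) (divr_gt0 e0 k0).
  have -> : (C + e / (b - a + 1)) * (b - a) + e / (b - a + 1) =
     C * (b - a) + e / (b - a + 1) * (b - a + 1) by ring.
  by rewrite divfK ?gt_eqF //; lra.
move=> e0; have [d d0 Hd] := acf _ e0.
(* The endpoints join the null set because the hypothesis gives no derivative there; the cover [U]
   then takes care of them. *)
have mE : measurable (N `|` [set a] `|` [set b]).
  by apply: measurableU; [apply: measurableU|].
have E0 : lam (N `|` [set a] `|` [set b]) = 0%E.
  have mNa : measurable (N `|` [set a]) by exact: measurableU.
  rewrite measureU0 //; last exact: lebesgue_measure_set1.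
  by rewrite measureU0 //; exact: lebesgue_measure_set1.
have [U [oU NU Ud]] := lebesgue_regularity_outer mE (eq_ind_r (fun x => (x < +oo)%E) (ltry 0) E0) d0.
have mU : measurable U by exact: measurable_realfun.open_measurable.
have lU : (lam U < d%:E)%E.
  have mD : measurable (U `\` (N `|` [set a] `|` [set b])) by exact: measurableD.
  rewrite -(setDUK NU) measureU //; last by rewrite setDE setICA setICr setI0.
  by rewrite [X in (X + _ < _)%E]E0 add0e.
(* The increment up to [t] is split into a linear part and the variation over finitely many
   intervals. Only their total length is compared with [U], which is enough to apply absolute
   continuity at the end. *)
pose good t := exists s : seq (R * R),
  [/\ forall p, p \in s -> [/\ a <= p.1, p.1 <= p.2 & p.2 <= t],
      pairwise (fun p q => (p.2 <= q.1) || (q.2 <= p.1)) s,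
      ((\sum_(p <- s) (p.2 - p.1))%:E <= lam (U `&` `]a, t]))%E
    & f t - f a <= (C + e) * (t - a) + \sum_(p <- s) `|f p.2 - f p.1|].
have : good b.
  apply: (@real_induction good a b) => //.
    exists [::]; split=> //; rewrite !big_nil //.
    by rewrite !subrr mulr0 addr0.
  move=> t /andP[at_ tb].
  (* Inside [U] the interval from [s] to [s'] is appended to the list, and the nonnegative linear
     term is given away; this is where [0 <= C] enters. *)
  have [tU|tU] := pselect (U t).
    have [r /= r0 Hr] := (@nbhs_ballP _ _ _ _).1 (open_nbhs_nbhs (conj oU tU)).
    exists r => // s s' as_ st ts' s'b str s'tr [l [l1 l2 l3 l4]].
    exists (rcons l (s, s')); split.
    - move=> p; rewrite mem_rcons inE => /orP[/eqP-> /=|/l1[? ? ?]];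
        split=> //; lra.
    - by apply: (@pairwise_disj_rcons _ _ s) => // p /l1[].
    - have -> : U `&` `]a, s'] = (U `&` `]a, s]) `|` `]s, s'].
        apply/seteqP; split=> x /=; rewrite !in_itv /=.
          move=> [Ux /andP[ax xs']]; have [xs|sx] := leP x s.
            by left; rewrite ax.
          by right.
        move=> [[Ux /andP[ax xs]]|/andP[sx xs']].
          by split=> //; rewrite ax (le_trans xs) // (le_trans st).
        split; last by apply/andP; split=> //; lra.
        apply: Hr; rewrite /ball /= ltr_norml; apply/andP; split; lra.
      rewrite measureU //; last 2 first.
      - exact: measurableI.
      - apply/seteqP; split=> // x /=; rewrite !in_itv /=.
        by move=> [[_ /andP[_ xs]] /andP[sx _]]; have := lt_le_trans sx xs; rewrite ltxx.
      rewrite big_rcons /= EFinD leeD //.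
      rewrite [lam _]lebesgue_measure_itv /= lte_fin; case: ltP => // s's.
      by rewrite lee_fin subr_le0.
    - rewrite big_rcons /=.
      have h1 : f s' - f s <= `|f s' - f s| by exact: ler_norm.
      have h2 : 0 <= (C + e) * (s' - s).
        by apply: mulr_ge0; [apply: addr_ge0 => //; exact: ltW | lra].
      lra.
  have [ta|ta] := eqVneq t a; first by case: tU; apply: NU; left; right.
  have [tb'|tb'] := eqVneq t b; first by case: tU; apply: NU; right.
  have aet : a < t by rewrite lt_neqAle eq_sym ta.
  have tltb : t < b by rewrite lt_neqAle tb'.
  have [df dft dfC] : exists2 df, is_derive t 1 f df & df <= C.
    apply: contrapT => h; apply: tU; apply: NU; left; left; apply: HN => /= h'.
    by apply: h; exact: h'.
  have [r r0 Hr] := is_derive_local_bound dft e0.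
  (* Since [t] lies between [s] and [s'], the two first-order estimates at [t] add up to a slope of
     at most [df + e] from [s] to [s']; the list stays the same. *)
  exists r => // s s' as_ st ts' s'b str s'tr [l [l1 l2 l3 l4]].
  exists l; split=> //.
  - by move=> p /l1[? ? ?]; split=> //; lra.
  - apply: le_trans l3 _; apply: le_measure; rewrite ?inE //.
    + exact: measurableI.
    + exact: measurableI.
    apply: setIS => x /=; rewrite !in_itv /= => /andP[-> xs] /=; lra.
  - have := Hr s; rewrite ler0_norm ?subr_le0 // opprB => /(_ str).
    rewrite ler_norml => /andP[h1 _].
    have := Hr s'; rewrite ger0_norm ?subr_ge0 // => /(_ s'tr).
    rewrite ler_norml => /andP[_ h2].
    have h3 : 0 <= (C - df) * (s' - s) by apply: mulr_ge0; lra.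
    lra.
case=> l [l1 l2 l3 l4].
have ld : \sum_(p <- l) (p.2 - p.1) < d.
  rewrite -lte_fin; apply: le_lt_trans l3 (le_lt_trans _ lU).
  by apply: le_measure; rewrite ?inE //; exact: measurableI.
have := Hd l l1 l2 ld; lra.
Qed.

End RealAnalysis.

(** * Lipschitz functions and their derivatives almost everywhere *)

Section Lipschitz.
Variable R : realType.
Implicit Types (f g : R -> R) (s t T : R).

(** The phases are Lipschitz because the vector field is bounded. This class is stable under sums
    and products on a bounded interval, hence contains the power sums, and it implies absolute
    continuity. *)
Definition lip_on T f := exists L, forall s t,
  0 <= s <= T -> 0 <= t <= T -> `|f s - f t| <= L * `|s - t|.

Lemma lip_on_ge0 T f : lip_on T f -> exists2 L, 0 <= L & forall s t,
  0 <= s <= T -> 0 <= t <= T -> `|f s - f t| <= L * `|s - t|.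
Proof.
move=> [L HL]; exists `|L|; first by [].
move=> s t sT tT; apply: le_trans (HL _ _ sT tT) _.
by rewrite ler_wpM2r // ler_norm.
Qed.

Lemma lip_on_cst T (c : R) : lip_on T (fun=> c).
Proof. by exists 0 => s t _ _; rewrite subrr normr0 mul0r. Qed.

Lemma lip_on_id T : lip_on T id.
Proof. by exists 1 => s t _ _; rewrite mul1r. Qed.

Lemma lip_onD T f g : lip_on T f -> lip_on T g -> lip_on T (f \+ g).
Proof.
move=> [L HL] [M HM]; exists (L + M) => s t sT tT /=.
rewrite mulrDl (le_trans _ (lerD (HL _ _ sT tT) (HM _ _ sT tT))) //.
by rewrite (le_trans _ (ler_normD _ _)) // opprD addrACA.
Qed.

Lemma lip_on_bounded T f : lip_on T f ->
  exists2 B, 0 <= B & forall t, 0 <= t <= T -> `|f t| <= B.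
Proof.
move=> /lip_on_ge0[L L0 HL]; exists (`|f 0| + L * `|T|).
  by rewrite addr_ge0 // mulr_ge0.
move=> t tT; case/andP: (tT) => t0 tT'.
have T0 : 0 <= T by exact: le_trans tT'.
rewrite -(subrK (f 0) (f t)) addrC (le_trans (ler_normD _ _)) // lerD2l.
apply: le_trans (HL _ _ tT _) _; first by rewrite lexx.
by rewrite ler_wpM2l // subr0 !ger0_norm.
Qed.

Lemma lip_onM T f g : lip_on T f -> lip_on T g -> lip_on T (f \* g).
Proof.
move=> lf lg; have [B B0 HB] := lip_on_bounded lf.
have [D D0 HD] := lip_on_bounded lg.
have [L L0 HL] := lip_on_ge0 lf; have [M M0 HM] := lip_on_ge0 lg.
exists (B * M + D * L) => s t sT tT /=.
have -> : f s * g s - f t * g t = f s * (g s - g t) + g t * (f s - f t) by ring.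
rewrite mulrDl (le_trans (ler_normD _ _)) // !normrM -!mulrA.
by rewrite lerD // ler_pM // ?HB ?HD ?HL ?HM.
Qed.

Lemma lip_onX T f n : lip_on T f -> lip_on T (fun t => f t ^+ n).
Proof.
move=> lf; elim: n => [|n IH]; first exact: lip_on_cst.
by under eq_fun do rewrite exprS; exact: lip_onM.
Qed.

Lemma lip_on_sum T (I : finType) (f : I -> R -> R) :
  (forall i, lip_on T (f i)) -> lip_on T (fun t => \sum_i f i t).
Proof.
move=> lf; elim: (index_enum I) => [|i r IH].
  by under eq_fun do rewrite big_nil; exact: lip_on_cst.
by under eq_fun do rewrite big_cons; exact: (lip_onD (lf i) IH).
Qed.

Lemma lip_on_ac T f a b : 0 <= a -> b <= T -> lip_on T f ->
  absolutely_continuous_on a b f.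
Proof.
move=> a0 bT /lip_on_ge0[L L0 HL] e e0; have L1 : 0 < L + 1 by lra.
exists (e / (L + 1)); first by rewrite divr_gt0.
move=> l H _; rewrite ltr_pdivlMr // => H'.
apply: le_lt_trans H'; rewrite mulr_suml big_seq [leRHS]big_seq.
apply: ler_sum => p /H[h1 h2 h3].
apply: le_trans (HL _ _ _ _) _; try (apply/andP; split; lra).
rewrite ger0_norm ?subr_ge0 // mulrC ler_wpM2l ?subr_ge0 //; lra.
Qed.

Lemma acN a b f : absolutely_continuous_on a b f ->
  absolutely_continuous_on a b (fun t => - f t).
Proof.
move=> H e /H[d d0 Hd]; exists d => // l h1 h2 h3.
by rewrite (eq_bigr _ (fun p _ => congr1 _ (esym (opprD _ _)))) (eq_bigr _ (fun p _ => normrN _)); exact: Hd.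
Qed.

Lemma ac_sub a b c d f : a <= c -> d <= b -> absolutely_continuous_on a b f ->
  absolutely_continuous_on c d f.
Proof.
move=> ac db H e /H[k k0 Hk]; exists k => // l h1; apply: Hk => p /h1[? ? ?].
by split=> //; lra.
Qed.

Lemma ac_lipschitz T f (C : R) : 0 <= C -> absolutely_continuous_on 0 T f ->
  {ae @lebesgue_measure R, forall t, 0 < t ->
     exists2 df, is_derive t 1 f df & `|df| <= C} ->
  forall s t, 0 <= s <= T -> 0 <= t <= T -> `|f s - f t| <= C * `|s - t|.
Proof.
move=> C0 acf H s t.
wlog st : s t / s <= t => [hw|] sT tT.
  have [st|/ltW ts] := leP s t; first exact: hw.
  by rewrite distrC [`|s - t|]distrC; exact: hw.
case/andP: sT => s0 sT; case/andP: tT => t0 tT.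
have acst := ac_sub s0 tT acf.
rewrite distrC [`|s - t|]distrC [`|t - s|]ger0_norm ?subr_ge0 // ler_norml.
apply/andP; split.
  rewrite lerNl opprB [f s - _]addrC -[f s]opprK -opprD opprD.
  apply: (@ac_increment_le _ (fun t => - f t)) => //; first exact: acN.
  apply: ae_imp H => x hx sx _; have [|df h1 h2] := hx; first by lra.
  exists (- df); first exact: is_deriveN.
  by move: h2; rewrite ler_norml; lra.
apply: ac_increment_le => //.
apply: ae_imp H => x hx sx _; have [|df h1 h2] := hx; first by lra.
by exists df => //; apply: le_trans h2; exact: ler_norm.
Qed.

(** Here [C] may be negative, as the decay of the variance demands. Adding the function [|C| * t]
    raises the bound to [C + |C|], which is nonnegative, and the two extra terms cancel in the
    conclusion. *)
Lemma lip_increment_le T f (C : R) s t : lip_on T f -> 0 <= s -> s <= t -> t <= T ->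
  {ae @lebesgue_measure R, forall u, s < u -> u < t ->
     exists2 df, is_derive u 1 f df & df <= C} ->
  f t - f s <= C * (t - s).
Proof.
move=> lf s0 st tT H.
suff : (f t + `|C| * t) - (f s + `|C| * s) <= (C + `|C|) * (t - s) by lra.
apply: (@ac_increment_le _ (fun t => f t + `|C| * t)) => //.
- by rewrite -lerBlDr sub0r lerNnormlW.
- apply: (@lip_on_ac T) => //; apply: (lip_onD lf).
  by apply: lip_onM; [exact: lip_on_cst | exact: lip_on_id].
apply: ae_imp H => u hu su ut; have [df h1 h2] := hu su ut.
exists (df + `|C|); last by rewrite lerD2r.
have h3 : is_derive u 1 ( *%R `|C|) `|C|.
  have := @is_deriveZ _ _ _ id `|C| u 1 1 (is_derive_id _ _).
  by rewrite /GRing.scale /= mulr1.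
exact: is_deriveD.
Qed.

Lemma is_derive_sumT (I : finType) (f : I -> R -> R) (df : I -> R) t :
  (forall i, is_derive t 1 (f i) (df i)) ->
  is_derive t 1 (fun s => \sum_i f i s) (\sum_i df i).
Proof.
move=> H; elim: (index_enum I) => [|i r IH].
  by under eq_fun do rewrite big_nil; rewrite big_nil; exact: is_derive_cst.
by under eq_fun do rewrite big_cons; rewrite big_cons; exact: is_deriveD.
Qed.

End Lipschitz.

(** * Trigonometric and graph inequalities *)

(** By the mean value theorem [sin y = y * cos c] for some [c] between [0] and [y], and the cosine
    decreases there. *)
Lemma sin_ge_cos_mul (R : realType) (r y : R) : 0 <= y -> y <= r -> r < pi / 2 ->
  y * cos r <= sin y.
Proof.
move=> y0 yr rpi; have p0 := pi_gt0 R.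
have [c|c cy] := @MVT_segment R sin cos 0 y y0 (fun x _ => is_derive_sin x).
  apply: continuous_subspaceT => x; exact: continuous_sin.
rewrite sin0 !subr0 => ->; rewrite mulrC ler_wpM2r //.
move: cy; rewrite in_itv /= => /andP[c0 cy].
by rewrite leNgt ltr_cos -?leNgt ?in_itv /=; try (apply/andP; split); lra.
Qed.

(** The range [2 * r] is that of a difference of two phases in a ball of radius [r]. Writing [sin x]
    as twice the product of sine and cosine of [x / 2] brings the angle below [r]; each of the two
    factors costs one [cos r]. *)
Lemma mul_sin_ge (R : realType) (r x : R) : 0 <= r -> r < pi / 2 -> `|x| <= 2 * r ->
  cos r ^+ 2 * x ^+ 2 <= x * sin x.
Proof.
move=> r0 rpi; have p0 := pi_gt0 R.
wlog x0 : x / 0 <= x => [hw|].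
  have [/hw//|/ltW x0 xr] := leP 0 x.
  by have := hw (- x); rewrite oppr_ge0 normrN sqrrN sinN mulrNN; exact.
rewrite ger0_norm // => xr.
have c0 : 0 <= cos r by apply: cos_ge0_pihalf; lra.
have h1 := @sin_ge_cos_mul R r (x / 2) ltac:(lra) ltac:(lra) rpi.
have h2 : cos r <= cos (x / 2).
  by rewrite leNgt ltr_cos -?leNgt ?in_itv /=; try (apply/andP; split); lra.
have -> : sin x = 2 * (sin (x / 2) * cos (x / 2)).
  rewrite {1}(_ : x = x / 2 + x / 2); last by field.
  by rewrite sinD; ring.
have -> : cos r ^+ 2 * x ^+ 2 = x * (2 * (x / 2 * cos r * cos r)) by field.
rewrite ler_wpM2l // ler_wpM2l // ler_pM //; apply: mulr_ge0 => //; lra.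
Qed.

(** An odd power is increasing, so both factors have the sign of [x - y]. *)
Lemma exprB_mul_sin_ge0 (R : realType) (x y : R) q : odd q -> `|x - y| <= pi ->
  0 <= (x ^+ q - y ^+ q) * sin (x - y).
Proof.
move=> oq.
have mono (u v : R) : u <= v -> u ^+ q <= v ^+ q.
  have [p ->] : exists p, q = p.*2.+1.
    by exists q./2; rewrite -{1}(odd_double_half q) oq.
  move=> uv; have odn : odd p.*2.+1 by rewrite /= odd_double.
  have [u0|u0] := leP 0 u.
    by rewrite lerXn2r // nnegrE // (le_trans u0).
  have [v0|v0] := leP 0 v.
    by rewrite (@le_trans _ _ 0) ?exprn_ge0 // ltW // exprn_odd_lt0.
  rewrite -[u]opprK -[v]opprK ![(- - _) ^+ _]exprNn -signr_odd odn expr1 !mulN1r.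
  by rewrite lerN2 lerXn2r ?nnegrE ?lerN2 // oppr_ge0 ltW.
wlog xy : x y / y <= x => [hw|].
  have [/hw//|/ltW yx] := leP y x.
  by move=> h; rewrite -mulrNN -sinN !opprB; apply: hw => //; rewrite distrC.
rewrite ger0_norm ?subr_ge0 // => h; apply: mulr_ge0.
  by rewrite subr_ge0 mono.
by apply: sin_ge0_pi; rewrite subr_ge0 xy.
Qed.

(** Exchanging the names of [i] and [j] and using the symmetry of [a] gives a second form of the
    same sum; the right-hand side is the total of the two forms. *)
Lemma sym_sum_mul_sin (R : realType) (I : finType) (a : I -> I -> R) (x y : I -> R) :
  (forall i j, a i j = a j i) ->
  2 * \sum_i x i * \sum_j a i j * sin (y j - y i) =
  - \sum_i \sum_j a i j * ((x i - x j) * sin (y i - y j)).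
Proof.
move=> asym.
have E1 : \sum_i x i * \sum_j a i j * sin (y j - y i) =
    - \sum_i \sum_j a i j * (x i * sin (y i - y j)).
  rewrite -sumrN; apply: eq_bigr => i _; rewrite mulr_sumr -sumrN.
  by apply: eq_bigr => j _; rewrite -opprB sinN; ring.
have E2 : \sum_i x i * \sum_j a i j * sin (y j - y i) =
    \sum_i \sum_j a i j * (x j * sin (y i - y j)).
  under eq_bigr do rewrite mulr_sumr.
  rewrite exchange_big /=; apply: eq_bigr => i _; apply: eq_bigr => j _.
  by rewrite asym; ring.
rewrite mulr_natl mulr2n {1}E1 E2 addrC -opprB; congr (- _).
rewrite -sumrB; apply: eq_bigr => i _; rewrite -sumrB; apply: eq_bigr => j _.
ring.
Qed.

Lemma sum_sqr_diff (R : realType) (I : finType) (x : I -> R) : \sum_i x i = 0 ->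
  \sum_i \sum_j (x i - x j) ^+ 2 = 2 * #|I|%:R * \sum_i x i ^+ 2.
Proof.
move=> x0.
have E i : \sum_j (x i - x j) ^+ 2 = #|I|%:R * x i ^+ 2 + \sum_j x j ^+ 2.
  have hx : \sum_j - (2 * x i) * x j = 0 by rewrite -mulr_sumr x0 mulr0.
  rewrite (eq_bigr (fun j : I => x i ^+ 2 + (- (2 * x i) * x j + x j ^+ 2))).
    by rewrite !big_split /= sumr_const hx add0r mulr_natl.
  by move=> j _; ring.
under eq_bigr => i _ do rewrite E.
by rewrite big_split /= -mulr_sumr sumr_const -[_ *+ #|_|]mulr_natl; ring.
Qed.

(** * A Poincaré inequality for connected weights *)

Section Poincare.
Variables (R : realType) (I : finType) (a : I -> I -> R).
Hypothesis a_ge0 : forall i j, 0 <= a i j.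
Hypothesis a_connected : forall i j, connect (fun u v => 0 < a u v) i j.

Local Notation energy x := (\sum_i \sum_j a i j * (x i - x j) ^+ 2).

(** Induction along a path from [u] to [v]: every edge of positive weight contributes one term of
    the energy, and the square of a sum is at most twice the sum of the squares. *)
Lemma sqr_diff_le_energy u v : exists2 C, 0 <= C &
  forall x : I -> R, (x u - x v) ^+ 2 <= C * energy x.
Proof.
have /connectP[p] := a_connected u v.
elim: p u => [|w p IH] u /= => [_ ->|/andP[auw pw] ev].
  by exists 0 => // x; rewrite subrr expr0n mul0r.
have [C C0 HC] := IH _ pw ev.
exists (2 * (a u w)^-1 + 2 * C).
  by rewrite addr_ge0 // mulr_ge0 // invr_ge0 ltW.
move=> x; have h1 : a u w * (x u - x w) ^+ 2 <= energy x.
  rewrite (bigD1 u) //= (bigD1 w) //= -addrA lerDl addr_ge0 //.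
    by apply: sumr_ge0 => j _; rewrite mulr_ge0 // sqr_ge0.
  by apply: sumr_ge0 => i _; apply: sumr_ge0 => j _; rewrite mulr_ge0 // sqr_ge0.
have h2 : (x u - x w) ^+ 2 <= (a u w)^-1 * energy x.
  by rewrite mulrC ler_pdivlMr // mulrC.
have h3 := HC x.
have h4 : (x u - x v) ^+ 2 <= 2 * (x u - x w) ^+ 2 + 2 * (x w - x v) ^+ 2.
  have := sqr_ge0 (x u - x w - (x w - x v)); lra.
lra.
Qed.

Lemma connected_energy_ge : exists2 lam, 0 < lam &
  forall x : I -> R, lam * \sum_i \sum_j (x i - x j) ^+ 2 <= energy x.
Proof.
have H (e : I * I) : exists C, 0 <= C /\
    forall x : I -> R, (x e.1 - x e.2) ^+ 2 <= C * energy x.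
  by have [C ? ?] := sqr_diff_le_energy e.1 e.2; exists C.
have [C HC] := choice H.
have C0 : 0 <= \sum_i \sum_j C (i, j).
  by apply: sumr_ge0 => i _; apply: sumr_ge0 => j _; case: (HC (i, j)).
exists (1 + \sum_i \sum_j C (i, j))^-1; first by rewrite invr_gt0; lra.
move=> x; rewrite mulrC ler_pdivrMr; last lra.
have e0 : 0 <= energy x.
  by apply: sumr_ge0 => i _; apply: sumr_ge0 => j _; rewrite mulr_ge0 // sqr_ge0.
have h : \sum_i \sum_j (x i - x j) ^+ 2 <= (\sum_i \sum_j C (i, j)) * energy x.
  rewrite mulr_suml; apply: ler_sum => i _; rewrite mulr_suml.
  by apply: ler_sum => j _; case: (HC (i, j)) => _; exact.
lra.
Qed.

End Poincare.

(** * Synchronization under a time-dependent coupling *)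

Section Synchronization.
Variables (R : realType) (I : finType) (K : R) (a : R -> I -> I -> R)
  (psi : R -> I -> R).
Hypothesis K_gt0 : 0 < K.
Hypothesis a_sym : forall t i j, a t i j = a t j i.
Hypothesis a_ge0 : forall t i j, 0 <= a t i j.
Variable A : R.
Hypothesis a_le : forall t i j, a t i j <= A.
Hypothesis psi_ac :
  forall (T : R) i, 0 < T -> absolutely_continuous_on 0 T (psi ^~ i : R -> R).
Hypothesis psi_derive : {ae (@lebesgue_measure R), forall t : R, (0 : R) < t -> forall i,
  is_derive t (1 : R) (psi ^~ i : R -> R)
    (kuramoto_field K (fun=> 0) (a t) (psi t) i)}.

Local Notation F t := (kuramoto_field K (fun=> 0) (a t) (psi t)).

Lemma kuramoto_lipschitz : exists2 L, 0 <= L & forall i s t, 0 <= s -> 0 <= t ->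
  `|psi s i - psi t i| <= L * `|s - t|.
Proof.
have k0 : 0 <= K / #|I|%:R by rewrite divr_ge0 // ltW.
exists (K / #|I|%:R * \sum_(j : I) `|A|).
  by apply: mulr_ge0 => //; exact: sumr_ge0.
move=> i s t s0 t0; have T0 : 0 < Num.max s t + 1.
  by rewrite ltr_pwDr // le_max s0.
apply: (@ac_lipschitz R (Num.max s t + 1) (psi ^~ i)) => //.
- by apply: mulr_ge0 => //; exact: sumr_ge0.
- exact: psi_ac.
- apply: ae_imp psi_derive => u hu u0; exists (F u i); first exact: hu.
  rewrite /kuramoto_field add0r normrM ger0_norm // ler_wpM2l //.
  apply: le_trans (ler_norm_sum _ _ _) _; apply: ler_sum => j _.
  rewrite normrM -[leRHS]mulr1 ler_pM //.
    by rewrite ger0_norm // (le_trans (a_le _ _ _)) // ler_norm.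
  by rewrite ler_norml sin_geN1 sin_le1.
- by rewrite s0 /= ler_wpDr // le_max lexx.
- by rewrite t0 /= ler_wpDr // le_max lexx orbT.
Qed.

Lemma kuramoto_lip_on i T : lip_on T (psi ^~ i).
Proof.
have [L L0 HL] := kuramoto_lipschitz.
by exists L => s t /andP[s0 _] /andP[t0 _]; exact: HL.
Qed.

Lemma power_sum_lip_on c q T : lip_on T (fun t => \sum_i (psi t i - c) ^+ q).
Proof.
apply: lip_on_sum => i; apply: lip_onX.
exact: (lip_onD (kuramoto_lip_on i T) (lip_on_cst T (- c))).
Qed.

(** After the chain rule the symmetrization [sym_sum_mul_sin] produces the factor [1 / 2] and a sum
    whose terms have a sign for odd [q]. *)
Lemma power_sum_derive (c : R) q (t : R) : (forall i, is_derive t 1 (psi ^~ i) (F t i)) ->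
  is_derive t 1 (fun s => \sum_i (psi s i - c) ^+ q.+1)
    (- (q.+1%:R * (K / #|I|%:R) / 2) * \sum_i \sum_j a t i j *
       (((psi t i - c) ^+ q - (psi t j - c) ^+ q) * sin (psi t i - psi t j))).
Proof.
move=> H; have dX i : is_derive t 1 (fun s => (psi s i - c) ^+ q.+1)
    (q.+1%:R * (psi t i - c) ^+ q * F t i).
  have h1 : is_derive t 1 (fun s => psi s i - c) (F t i).
    have := is_deriveD (H i) (is_derive_cst (- c) t 1).
    by rewrite addr0.
  by have := is_deriveX q.+1 h1; rewrite exprfctE.
apply: is_derive_eq (is_derive_sumT dX) _.
rewrite mulNr -mulrN -(@sym_sum_mul_sin _ _ (a t) (fun i => (psi t i - c) ^+ q) (psi t)) //.
rewrite mulrA !mulr_sumr; apply: eq_bigr => i _.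
rewrite /kuramoto_field add0r; field.
by rewrite pnatr_eq0 -lt0n; apply/card_gt0P; exists i.
Qed.

Lemma power_sum_antitone c q T : odd q ->
  (forall s i j, 0 <= s <= T -> `|psi s i - psi s j| <= pi) ->
  forall s t, 0 <= s -> s <= t -> t <= T ->
    \sum_i (psi t i - c) ^+ q.+1 <= \sum_i (psi s i - c) ^+ q.+1.
Proof.
move=> oq hpi s t s0 st tT; rewrite -subr_le0 -[leRHS](mul0r (t - s)).
apply: (@lip_increment_le R T (fun t => \sum_i (psi t i - c) ^+ q.+1) 0 s t) => //.
  exact: power_sum_lip_on.
apply: ae_imp psi_derive => u hu su ut.
have u0 : 0 < u by exact: le_lt_trans su.
eexists; first exact: (power_sum_derive c q (hu u0)).
rewrite mulNr oppr_le0 mulr_ge0 //.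
  by rewrite !(divr_ge0, mulr_ge0) // ltW.
apply: sumr_ge0 => i _; apply: sumr_ge0 => j _; rewrite mulr_ge0 //.
have -> : psi u i - psi u j = (psi u i - c) - (psi u j - c) by ring.
apply: exprB_mul_sin_ge0 => //.
have -> : (psi u i - c) - (psi u j - c) = psi u i - psi u j by ring.
by apply: hpi; lra.
Qed.

(* The power sums of large order approximate the maximum of [|psi_i - c|]: once
   all phases are in a ball of radius [r], they cannot leave a ball of radius
   [r' > r]. *)
Lemma phases_stay_close c r r' : 0 <= r -> r < r' -> r' < pi / 2 ->
  (forall i, `|psi 0 i - c| <= r) ->
  forall t i, 0 <= t -> `|psi t i - c| <= r'.
Proof.
move=> r0 rr' r'pi h0.
have r'0 : 0 < r' by exact: le_lt_trans rr'.
(* The ratio [r / r'] is below [1], so its powers beat the number of phases; the odd exponent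
   [2n + 1] is taken so that [q.+1] is even and at least [n]. *)
have [q oq hq] : exists2 q, odd q & #|I|%:R * r ^+ q.+1 < r' ^+ q.+1.
  have rho : `|r / r'| < 1 by rewrite ger0_norm ?(divr_ge0 r0 (ltW r'0)) // ltr_pdivrMr // mul1r.
  have : #|I|%:R * (r / r') ^+ n @[n --> \oo] --> #|I|%:R * (0 : R).
    by apply: cvgM; [exact: cvg_cst | exact: cvg_expr].
  rewrite mulr0 => /cvgrPdist_lt/(_ _ ltr01) [n _ Hn]; exists n.*2.+1; first by rewrite /= odd_double.
  have /Hn : (n <= n.*2.+2)%N by rewrite -addnn -2!addnS leq_addr.
  rewrite /= sub0r normrN => /(le_lt_trans (ler_norm _)).
  by rewrite expr_div_n mulrA ltr_pdivrMr ?exprn_gt0 // mul1r.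
have [L L0 HL] := kuramoto_lipschitz.
(* Within time [e] no phase moves by more than [pi / 2 - r']. *)
pose e := (pi / 2 - r') / (L + 1).
have L1 : 0 < L + 1 by lra.
have e0 : 0 < e by rewrite divr_gt0 //; lra.
have Le : L * e <= pi / 2 - r'.
  by rewrite /e mulrCA ger_pMr ?ler_pdivrMr ?subr_gt0 //; lra.
(* On the next time step the phases are within [pi / 2] of [c], hence within [pi] of each other, and
   the power sum decreases. It is always compared with its value at time [0], so the bound [r'] is
   recovered without loss. *)
have step (k : nat) : forall t i, 0 <= t <= k%:R * e -> `|psi t i - c| <= r'.
  elim: k => [|k IH] t i.
    rewrite mul0r -eq_le => /eqP <-; exact: le_trans (h0 i) (ltW rr').
  have near_half s j : 0 <= s <= k.+1%:R * e -> `|psi s j - c| <= pi / 2.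
    case/andP=> s0 se; have [sk|ks] := leP s (k%:R * e).
      by apply: le_trans (IH s j _) (ltW r'pi); rewrite s0.
    have k0 : 0 <= k%:R * e by rewrite mulr_ge0 // ltW.
    have h1 : `|psi (k%:R * e) j - c| <= r' by apply: IH; rewrite k0 lexx.
    have h2 := HL j s (k%:R * e) s0 k0.
    have h3 : `|s - k%:R * e| <= e.
      rewrite gtr0_norm ?subr_gt0 //; move: se; rewrite -natr1; lra.
    have h4 : L * `|s - k%:R * e| <= L * e by rewrite ler_wpM2l.
    have -> : psi s j - c = (psi s j - psi (k%:R * e) j) + (psi (k%:R * e) j - c) by ring.
    apply: le_trans (ler_normD _ _) _; lra.
  case/andP=> t0 te.
  have close s j l : 0 <= s <= k.+1%:R * e -> `|psi s j - psi s l| <= pi.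
    move=> hs; have := near_half s j hs; have := near_half s l hs.
    by rewrite !ler_norml => /andP[? ?] /andP[? ?]; apply/andP; split; lra.
  have h1 := @power_sum_antitone c q _ oq close 0 t (lexx 0) t0 te.
  have q2 : ~~ odd q.+1 by rewrite /= oq.
  have h2 : `|psi t i - c| ^+ q.+1 <= \sum_i (psi t i - c) ^+ q.+1.
    rewrite -normrX ger0_norm ?exprn_even_ge0 // (bigD1 i) //= lerDl.
    by apply: sumr_ge0 => j _; apply: exprn_even_ge0.
  have h3 : \sum_i (psi 0 i - c) ^+ q.+1 <= #|I|%:R * r ^+ q.+1.
    rewrite mulr_natl -sumr_const; apply: ler_sum => j _.
    by rewrite -[leLHS]ger0_norm ?exprn_even_ge0 // normrX lerXn2r // nnegrE.
  have : `|psi t i - c| ^+ q.+1 < r' ^+ q.+1 by lra.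
  by rewrite ltr_pXn2r // ?nnegrE; [exact: ltW | exact: ltW].
move=> t i t0; apply: (step (Num.truncn (t / e)).+1).
rewrite t0 /= -ler_pdivrMr // ltW // truncnS_gt //.
Qed.

(** This is the exponent [q = 0] in [power_sum_derive]: the differences of zeroth powers vanish, and
    both signs of the increment are bounded by [0]. *)
Lemma kuramoto_sum_constant t : 0 <= t -> \sum_i psi t i = \sum_i psi 0 i.
Proof.
move=> t0; pose S t := \sum_i (psi t i - 0) ^+ 1.
have SE u : \sum_i psi u i = S u by apply: eq_bigr => i _; rewrite expr1 subr0.
have dS : {ae (@lebesgue_measure R), forall u : R, 0 < u -> is_derive u 1 S 0}.
  apply: ae_imp psi_derive => u hu u0.
  apply: is_derive_eq (power_sum_derive 0 0 (hu u0)) _.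
  rewrite big1 ?mulr0 // => i _; rewrite big1 // => j _.
  by rewrite !expr0 subrr mul0r mulr0.
have lS : lip_on t S by exact: power_sum_lip_on.
apply/eqP; rewrite !SE -subr_eq0 eq_le; apply/andP; split.
  rewrite -[leRHS](mul0r (t - 0)); apply: (lip_increment_le lS) => //.
  by apply: ae_imp dS => u hu u0 _; exists 0 => //; exact: hu.
rewrite -oppr_le0 opprB addrC -[X in _ + X]opprK -[leRHS](mul0r (t - 0)).
apply: (@lip_increment_le R t (fun u => - S u) 0 0 t) => //.
  have := lip_onM (lip_on_cst t (- 1)) lS.
  by congr lip_on; apply/funext => u /=; rewrite mulN1r.
apply: ae_imp dS => u hu u0 _; exists (- 0); last by rewrite oppr0.
by apply: is_deriveN; exact: hu.
Qed.

Section Decay.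
Variable r : R.
Hypotheses (r_ge0 : 0 <= r) (r_lt : r < pi / 2).
Hypothesis psi_close : forall (t : R) i j, 0 <= t -> `|psi t i - psi t j| <= 2 * r.

Let mean := (\sum_i psi 0 i) / #|I|%:R.
Let var t := \sum_i (psi t i - mean) ^+ 2.

Let var_antitone (s t : R) : 0 <= s -> s <= t -> var t <= var s.
Proof.
move=> s0 st; apply: (@power_sum_antitone mean 1 t) => // u i j /andP[u0 _].
by apply: le_trans (psi_close i j u0) _; have := r_lt; lra.
Qed.

Lemma variance_decay (b : I -> I -> R) (lam s h : R) :
  0 <= lam ->
  (forall x : I -> R, lam * \sum_i \sum_j (x i - x j) ^+ 2 <=
     \sum_i \sum_j b i j * (x i - x j) ^+ 2) ->
  0 <= s -> 0 <= h -> (forall t, s <= t < s + h -> a t = b) ->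
  var (s + h) + 2 * K * cos r ^+ 2 * lam * h * var (s + h) <= var s.
Proof.
move=> lam0 Hlam s0 h0 ab; set mu := 2 * K * cos r ^+ 2 * lam.
(* [var] is antitone, so that [var' <= - mu * var] is at most [- mu * var (s + h)]. *)
suff : var (s + h) - var s <= (- (mu * var (s + h))) * (s + h - s) by lra.
apply: (@lip_increment_le R (s + h) var) => //; first exact: power_sum_lip_on.
  by rewrite lerDl.
apply: ae_imp psi_derive => u hu su ush; have u0 : 0 < u by exact: le_lt_trans su.
eexists; first exact: (power_sum_derive mean 1 (hu u0)).
have [n0|n0] := eqVneq #|I| 0.
  have I0 (i : I) : False by have : (0 < #|I|)%N by [apply/card_gt0P; exists i]; rewrite n0.
  have sum0 (f : I -> R) : \sum_i f i = 0 by apply: big1 => i; case: (I0 i).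
  by rewrite /var !sum0 !mulr0.
have nR : (0 : R) < #|I|%:R by rewrite ltr0n lt0n.
rewrite ab; last by rewrite (ltW su).
have hV : var (s + h) <= var u by apply: var_antitone; exact: ltW.
have mu0 : 0 <= mu.
  apply: mulr_ge0 => //; apply: mulr_ge0; last exact: sqr_ge0.
  by rewrite mulr_ge0 // ltW.
apply: (@le_trans _ _ (- (mu * var u))); last by rewrite lerN2 ler_wpM2l.
(* The sum of the phases is conserved, so the initial mean is still the mean at time [u]; only then
   is the double sum of squared differences a multiple of [var u]. *)
have x0 : \sum_i (psi u i - mean) = 0.
  rewrite sumrB (kuramoto_sum_constant (ltW u0)) sumr_const -mulr_natr /mean.
  by rewrite divfK ?subrr // gt_eqF.
have h1 := Hlam (fun i => psi u i - mean).
rewrite (sum_sqr_diff x0) -/(var u) in h1.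
have b0 i j : 0 <= b i j by rewrite -(ab u) // (ltW su).
have h2 : cos r ^+ 2 * \sum_i \sum_j b i j * (psi u i - mean - (psi u j - mean)) ^+ 2 <=
   \sum_i \sum_j b i j * (((psi u i - mean) ^+ 1 - (psi u j - mean) ^+ 1) *
     sin (psi u i - psi u j)).
  rewrite mulr_sumr; apply: ler_sum => i _; rewrite mulr_sumr; apply: ler_sum => j _.
  rewrite mulrCA ler_wpM2l // !expr1.
  have -> : psi u i - mean - (psi u j - mean) = psi u i - psi u j by ring.
  by apply: mul_sin_ge => //; apply: psi_close; exact: ltW.
rewrite mulNr lerN2; apply: le_trans (ler_wpM2l _ h2); last first.
  by rewrite !(mulr_ge0, divr_ge0) // ltW.
have h3 := ler_wpM2l (sqr_ge0 (cos r)) h1.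
apply: le_trans (ler_wpM2l _ h3); last by rewrite !(mulr_ge0, divr_ge0) // ltW.
rewrite le_eqVlt; apply/orP; left; apply/eqP; rewrite /mu; field.
by rewrite gt_eqF.
Qed.

(** If the variance never fell below some [e > 0], each window would lower it by at least [mu * e],
    and infinitely many windows would exhaust [var 0]. Since the variance is antitone, being small
    once means being small forever. *)
Lemma variance_cvg0_sync (b : I -> I -> R) h :
  (forall i j, connect (fun u v => 0 < b u v) i j) -> 0 < h ->
  (forall l, exists s, [/\ 0 <= s, l <= s & forall t, s <= t < s + h -> a t = b]) ->
  forall i, psi t i @[t --> +oo] --> mean.
Proof.
move=> conn h0 win.
have b0 i j : 0 <= b i j.
  have [s [_ _ H]] := win 0; rewrite -(H s) // lexx ltrDl //.
have [lam lam0 Hlam] := connected_energy_ge b0 conn.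
pose mu := 2 * K * cos r ^+ 2 * lam * h.
have p0 := pi_gt0 R.
have c0 : 0 < cos r by apply: cos_gt0_pihalf; have := r_lt; have := r_ge0; lra.
have mu0 : 0 < mu by rewrite !mulr_gt0 ?exprn_gt0.
have var_small e : 0 < e -> exists2 t, 0 <= t & var t < e.
  move=> e0; apply: contrapT => hne.
  have ge_e t : 0 <= t -> e <= var t.
    by move=> t0; rewrite leNgt; apply/negP => hlt; apply: hne; exists t.
  have step k : exists2 t, 0 <= t & var t + k%:R * (mu * e) <= var 0.
    elim: k => [|k [t t0 IH]]; first by exists 0 => //; rewrite mul0r addr0.
    have [s [s0 ts H]] := win t.
    have sh0 : 0 <= s + h by rewrite addr_ge0 // ltW.
    exists (s + h) => //.
    have h1 := variance_decay (ltW lam0) Hlam s0 (ltW h0) H.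
    have h2 := var_antitone t0 ts.
    have h3 : mu * e <= mu * var (s + h) by rewrite ler_pM2l // ge_e.
    by rewrite -natr1; rewrite -/mu in h1; lra.
  have [t t0] := step (Num.truncn (var 0 / (mu * e))).+1.
  have := truncnS_gt (var 0 / (mu * e)).
  rewrite ltr_pdivrMr ?mulr_gt0 // => h1 h2.
  have := ge_e t t0; lra.
move=> i; apply/cvgrPdist_lt => e e0.
have [t t0 Vt] := var_small (e ^+ 2) (exprn_gt0 _ e0).
exists t; split; first exact: num_real.
move=> u tu; have Vu : var u < e ^+ 2.
  by apply: le_lt_trans Vt; apply: var_antitone => //; exact: ltW.
have : `|mean - psi u i| ^+ 2 < e ^+ 2.
  apply: le_lt_trans Vu; rewrite distrC -normrX ger0_norm ?sqr_ge0 //.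
  by rewrite /var (bigD1 i) //= lerDl sumr_ge0 // => j _; exact: sqr_ge0.
by rewrite ltr_pXn2r ?nnegrE // ltW.
Qed.

End Decay.

Lemma kuramoto_sync (c r : R) (b : I -> I -> R) (h : R) :
  0 <= r -> r < pi / 2 -> (forall i, `|psi 0 i - c| <= r) ->
  (forall i j, connect (fun u v => 0 < b u v) i j) -> 0 < h ->
  (forall l, exists s, [/\ 0 <= s, l <= s & forall t, s <= t < s + h -> a t = b]) ->
  exists l : R, forall i, psi t i @[t --> +oo] --> l.
Proof.
(* The midpoint [r'] leaves room on both sides: above [r] for the power sums, below [pi / 2] for a
   positive cosine. *)
move=> r0 rpi hr conn h0 win; pose r' := (r + pi / 2) / 2.
have r'0 : 0 <= r' by rewrite /r'; lra.
have r'pi : r' < pi / 2 by rewrite /r'; lra.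
have rr' : r < r' by rewrite /r'; lra.
eexists; apply: (variance_cvg0_sync r'0 r'pi _ conn h0 win) => t i j t0.
have := phases_stay_close r0 rr' r'pi hr i t0.
have := phases_stay_close r0 rr' r'pi hr j t0.
by rewrite !ler_norml => /andP[? ?] /andP[? ?]; apply/andP; split; lra.
Qed.

End Synchronization.

(** * Recurrence of a Markov chain to a constant window *)

Section MarkovWindows.
Variables (R : realType) (d : measure_display) (Omega : measurableType d).
Variables (P : probability Omega R) (S : finType) (Z : R -> Omega -> S)
  (p : R -> S -> S -> R).
Hypothesis Z_measurable : forall (t : R) x, 0 <= t -> measurable [set w | Z t w = x].
Hypothesis Z_markov : markov_property P Z p.

Local Notation pr A := (fine (P A)).
Local Notation past_event past :=
  [set w | forall r : R * S, r \in past -> Z r.1 w = r.2].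

Let prE (A : set Omega) : measurable A -> P A = (pr A)%:E.
Proof. by move=> mA; rewrite fineK // fin_num_measure. Qed.

Let pr_ge0 (A : set Omega) : 0 <= pr A.
Proof. by rewrite fine_ge0. Qed.

Let prD (A B : set Omega) : measurable A -> measurable B -> B `<=` A ->
  pr (A `\` B) = pr A - pr B.
Proof.
move=> mA mB BA; rewrite measureD //; last by rewrite ltey_eq fin_num_measure.
by rewrite (setIidr BA) fineB // fin_num_measure.
Qed.

Let pr_partition (t : R) (A : set Omega) : 0 <= t -> measurable A ->
  pr A = \sum_x pr (A `&` [set w | Z t w = x]).
Proof.
move=> t0 mA.
have mB x : measurable (A `&` [set w | Z t w = x]).
  by apply: measurableI => //; exact: Z_measurable.
have -> : P A = (\sum_x P (A `&` [set w | Z t w = x]))%E.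
  have AE : A = \bigcup_(x in [set` index_enum S]) (A `&` [set w | Z t w = x]).
    apply/seteqP; split => [w Aw|w [x _ []//]].
    by exists (Z t w) => //=; rewrite mem_index_enum.
  rewrite {1}AE measure_fin_bigcup //.
    by rewrite -fsbig_seq ?index_enum_uniq.
  by move=> x y _ _ [w [[_ <-] [_ <-]]].
by under eq_bigr => x _ do rewrite prE //; rewrite sumEFin.
Qed.

(* Events for which the Markov property holds from time [s] on. This class
   contains the cylinders before time [s] and is stable under relative
   complements. *)
Definition history_event (s : R) (D : set Omega) :=
  measurable D /\ forall (past : seq (R * S)) (t h : R) x y, s <= t -> 0 <= h ->
    (forall r : R * S, r \in past -> 0 <= r.1 <= t) ->
    pr (D `&` past_event past `&` [set w | Z t w = x] `&` [set w | Z (t + h) w = y]) =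
    pr (D `&` past_event past `&` [set w | Z t w = x]) * p h x y.

Lemma measurable_past_event (past : seq (R * S)) : (forall r, r \in past -> 0 <= r.1) ->
  measurable (past_event past).
Proof.
elim: past => [|r past IH] h.
  by rewrite (_ : [set _ | _] = setT) //; apply/seteqP.
have -> : past_event (r :: past) = [set w | Z r.1 w = r.2] `&` past_event past.
  apply/seteqP; split=> w /=.
    by move=> H; split=> [|r' rp]; apply: H; rewrite inE ?eqxx ?rp ?orbT.
  by move=> [h1 h2] r'; rewrite inE => /predU1P[->//|]; exact: h2.
have m1 : measurable [set w | Z r.1 w = r.2].
  by apply: Z_measurable; apply: h; rewrite inE eqxx.
have m2 : measurable (past_event past).
  by apply: IH => r' rp; apply: h; rewrite inE rp orbT.
exact: measurableI m1 m2.
Qed.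

Lemma history_eventT : history_event 0 setT.
Proof.
split=> // past t h x y t0 h0 hp; rewrite !setTI.
have mB : measurable (past_event past `&` [set w | Z t w = x]).
  apply: measurableI; last exact: Z_measurable.
  by apply: measurable_past_event => r /hp/andP[].
by rewrite Z_markov // [X in (X * _)%E]prE.
Qed.

Lemma history_eventW s u D : s <= u -> history_event s D -> history_event u D.
Proof.
move=> su [mD hD]; split=> // past t h x y ut; apply: hD; exact: le_trans ut.
Qed.

(** The new condition becomes one more entry of the list of past observations. *)
Lemma history_eventI s u D z : s <= u -> 0 <= u -> history_event s D ->
  history_event u (D `&` [set w | Z u w = z]).
Proof.
move=> su u0 [mD hD]; split; first by apply: measurableI => //; exact: Z_measurable.
move=> past t h x y ut h0 hp.
have -> : D `&` [set w | Z u w = z] `&` past_event past =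
    D `&` past_event ((u, z) :: past).
  rewrite -setIA; congr (_ `&` _); apply/seteqP; split=> w /=.
    by move=> [h1 h2] r'; rewrite inE => /predU1P[->//|]; exact: h2.
  move=> H; split=> [|r' rp]; last by apply: H; rewrite inE rp orbT.
  by apply: (H (u, z)); rewrite inE eqxx.
apply: hD => //; first exact: le_trans ut.
by move=> r; rewrite inE => /predU1P[->/=|/hp//]; rewrite u0.
Qed.

(** Both sides of the Markov identity are additive in [D]. This covers the event of having missed
    earlier windows, which is not a cylinder. *)
Lemma history_eventD s D D' : 0 <= s -> D' `<=` D ->
  history_event s D -> history_event s D' -> history_event s (D `\` D').
Proof.
move=> s0 D'D [mD hD] [mD' hD']; split; first exact: measurableD.
move=> past t h x y st h0 hp.
have t0 : 0 <= t by exact: le_trans st.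
pose E1 := past_event past `&` [set w | Z t w = x].
pose E2 := E1 `&` [set w | Z (t + h) w = y].
have mE1 : measurable E1.
  apply: measurableI; last exact: Z_measurable.
  by apply: measurable_past_event => r /hp/andP[].
have mE2 : measurable E2.
  by apply: measurableI => //; apply: Z_measurable; rewrite addr_ge0.
have sub E : measurable E -> pr ((D `\` D') `&` E) = pr (D `&` E) - pr (D' `&` E).
  move=> mE; rewrite -prD.
  - congr (fine (P _)); apply/seteqP; split=> w /=; last tauto.
    by move=> [[? ?] ?]; split=> // -[].
  - exact: measurableI.
  - exact: measurableI.
  - exact: setSI.
have := sub E2 mE2; have := sub E1 mE1.
rewrite /E2 /E1 !setIA => -> ->; rewrite mulrBl.
by rewrite hD // hD'.
Qed.

Section Window.
Variables (z : S) (h delta : R).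
Hypotheses (h_gt0 : 0 < h) (delta_gt0 : 0 < delta) (delta_le1 : delta <= 1).
Hypothesis hit_ge : forall x, delta <= p h x z.
Hypothesis stay_ge : forall m, delta <= p (h / (2 ^ m)%:R) z z ^+ (2 ^ m).

Definition grid_event (s eta : R) (n : nat) :=
  [set w | forall j, (j <= n)%N -> Z (s + j%:R * eta) w = z].

Lemma grid_event0 s eta : grid_event s eta 0 = [set w | Z s w = z].
Proof.
apply/seteqP; split=> w /=; first by move/(_ 0%N (leqnn _)); rewrite mul0r addr0.
by move=> H j; rewrite leqn0 => /eqP->; rewrite mul0r addr0.
Qed.

Lemma grid_eventS s eta n : grid_event s eta n.+1 =
  grid_event s eta n `&` [set w | Z (s + n.+1%:R * eta) w = z].
Proof.
apply/seteqP; split=> w /=.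
  by move=> H; split=> [j jn|]; apply: H => //; exact: leqW.
by move=> [h1 h2] j; rewrite leq_eqVlt => /predU1P[->|/h1].
Qed.

Lemma history_grid_event u s eta n D : 0 <= u -> u <= s -> 0 <= eta ->
  history_event u D ->
  history_event (s + n%:R * eta) (D `&` grid_event s eta n) /\
  pr (D `&` grid_event s eta n) = pr (D `&` [set w | Z s w = z]) * p eta z z ^+ n.
Proof.
move=> u0 us eta0 hD; have s0 : 0 <= s by exact: le_trans us.
elim: n => [|n [IH1 IH2]].
  rewrite grid_event0 expr0 mulr1 mul0r addr0; split=> //.
  exact: history_eventI hD.
have sn0 k : 0 <= s + k%:R * eta by rewrite addr_ge0 // mulr_ge0.
rewrite grid_eventS setIA; split.
  apply: history_eventI IH1 => //.
  by rewrite lerD2l ler_wpM2r // ler_nat.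
have [_ H] := IH1.
have := H [::] (s + n%:R * eta) eta z z (lexx _) eta0 ltac:(by []).
have -> : past_event [::] = setT by apply/seteqP.
have -> : D `&` grid_event s eta n `&` setT `&` [set w | Z (s + n%:R * eta) w = z] =
   D `&` grid_event s eta n.
  by rewrite setIT; apply/seteqP; split=> w /=; [case|move=> [? g]; split=> //; exact: g].
by rewrite -natr1 mulrDl mul1r addrA exprSr mulrA -IH2.
Qed.

(** The event is split according to the state at time [u]; the bound [delta] is uniform in that
    state. *)
Lemma history_hit_ge u D : 0 <= u -> history_event u D ->
  delta * pr D <= pr (D `&` [set w | Z (u + h) w = z]).
Proof.
move=> u0 [mD hD].
have mDz : measurable (D `&` [set w | Z (u + h) w = z]).
  by apply: measurableI => //; apply: Z_measurable; rewrite addr_ge0 // ltW.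
rewrite (pr_partition u0 mD) (pr_partition u0 mDz) mulr_sumr.
apply: ler_sum => x _.
have := hD [::] u h x z (lexx _) (ltW h_gt0) ltac:(by []).
have -> : past_event [::] = setT by apply/seteqP.
by rewrite setIT => {}hD; rewrite setIAC hD mulrC ler_wpM2l.
Qed.

(** One factor [delta] pays for reaching [z] in time [h], the other for being at [z] on the whole
    grid. *)
Lemma history_window_ge u D m : 0 <= u -> history_event u D ->
  delta ^+ 2 * pr D <= pr (D `&` grid_event (u + h) (h / (2 ^ m)%:R) (2 ^ m)).
Proof.
move=> u0 hD.
have eta0 : 0 <= h / (2 ^ m)%:R by rewrite divr_ge0 // ltW.
have uh : u <= u + h by rewrite lerDl ltW.
have [_ ->] := history_grid_event (2 ^ m) u0 uh eta0 hD.
apply: (@le_trans _ _ ((delta * pr D) * delta)).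
  by rewrite le_eqVlt; apply/orP; left; apply/eqP; ring.
by rewrite ler_pM ?mulr_ge0 ?stay_ge ?history_hit_ge // ltW.
Qed.

Let step := 2 * h.

(* The windows are [(2k+1)h, (2k+2)h]: the time [h] between two of them serves
   to come back to [z]. *)
Definition window_event (m k : nat) :=
  grid_event (k%:R * step + h) (h / (2 ^ m)%:R) (2 ^ m).

Lemma window_event_antitone m m' k : (m <= m')%N ->
  window_event m' k `<=` window_event m k.
Proof.
move=> mm' w H j jm; have := H (j * 2 ^ (m' - m))%N.
have -> : (2 ^ m' = 2 ^ m * 2 ^ (m' - m))%N by rewrite -expnD subnKC.
rewrite leq_mul2r jm orbT => /(_ isT) <-; congr (Z (_ + _) _).
rewrite !natrM; field.
by rewrite !pnatr_eq0 !expn_eq0.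
Qed.

(** The windows [l, ..., l + k - 1] all fail on the grid of level [m]. The recursion by relative
    complements matches [history_eventD]. *)
Fixpoint missed_event (m l k : nat) : set Omega :=
  if k is k'.+1 then missed_event m l k' `\` window_event m (l + k')
  else setT.

Lemma missed_eventP m l k w :
  missed_event m l k w <-> forall i, (i < k)%N -> ~ window_event m (l + i) w.
Proof.
elim: k => [|k IH] /=; first by split.
split=> [[/IH h1 h2] i|H].
  by rewrite ltnS leq_eqVlt => /predU1P[->//|]; exact: h1.
by split; [apply/IH => i ik; apply: H; exact: leqW | exact: H].
Qed.

Let step_ge0 k : 0 <= k%:R * step.
Proof. by rewrite mulr_ge0 // mulr_ge0 // ltW. Qed.

Lemma missed_event_le m l k :
  history_event ((l + k)%:R * step) (missed_event m l k) /\
  pr (missed_event m l k) <= (1 - delta ^+ 2) ^+ k.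
Proof.
have d2 : 0 <= 1 - delta ^+ 2 by rewrite subr_ge0 exprn_ile1 // ltW.
elim: k => [|k [hE IH]] /=.
  rewrite addn0 expr0 probability_setT; split=> //.
  exact: history_eventW history_eventT.
set E := missed_event m l k in hE IH *; set u := (l + k)%:R * step.
(* [history_eventD] asks for the removed event to be contained in [E]. *)
have -> : E `\` window_event m (l + k) = E `\` (E `&` window_event m (l + k)).
  by apply/seteqP; split=> w /=; tauto.
have eta0 : 0 <= h / (2 ^ m)%:R by rewrite divr_ge0 // ltW.
have uh : u <= u + h by rewrite lerDl ltW.
have [hW _] := history_grid_event (2 ^ m) (step_ge0 _) uh eta0 hE.
have uS : u + h + (2 ^ m)%:R * (h / (2 ^ m)%:R) = (l + k.+1)%:R * step.
  rewrite /u addnS -natr1 /step; field.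
  by rewrite pnatr_eq0 expn_eq0.
rewrite uS in hW.
have uu : u <= (l + k.+1)%:R * step.
  by rewrite ler_wpM2r ?ler_nat ?addnS // mulr_ge0 // ltW.
split; first by apply: history_eventD => //; exact: history_eventW hE.
rewrite prD //; [|by case: hE|by case: hW].
have hw := history_window_ge m (step_ge0 _) hE.
rewrite exprS; apply: le_trans (ler_wpM2l d2 IH).
rewrite mulrBl mul1r lerD2l lerN2; exact: hw.
Qed.

Lemma recurrent_windows : {ae P, forall w, forall l, exists2 k, (l <= k)%N &
  forall m, window_event m k w}.
Proof.
(* For each [k], one common level [m] reveals that the [k] windows from [l] on fail. The union over
   [m] is increasing, so the geometric bound, uniform in [m], survives in the limit. *)
pose bad l := \bigcap_k \bigcup_m missed_event m l k.
have mE m l k : measurable (missed_event m l k).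
  by have [[]] := missed_event_le m l k.
have mU l k : measurable (\bigcup_m missed_event m l k).
  exact: bigcupT_measurable.
have bad0 l : P (bad l) = 0%E.
  have mb : measurable (bad l) by exact: bigcapT_measurable.
  have le_pow k : (P (bad l) <= ((1 - delta ^+ 2) ^+ k)%:E)%E.
    apply: (@le_trans _ _ (P (\bigcup_m missed_event m l k))).
      by apply: le_measure; rewrite ?inE // => w; exact.
    have cv : P (missed_event m l k) @[m --> \oo] --> P (\bigcup_m missed_event m l k).
      apply: nondecreasing_cvg_mu => // m m' mm'.
      apply/subsetPset => w /missed_eventP H; apply/missed_eventP => i /H.
      by apply: contra_not; exact: window_event_antitone.
    rewrite -(cvg_lim _ cv) //; apply: lime_le; first by apply/cvg_ex; eexists; exact: cv.
    apply: nearW => m; rewrite prE // lee_fin.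
    by have [] := missed_event_le m l k.
  have : pr (bad l) <= 0.
    have rho : `|1 - delta ^+ 2| < 1.
      rewrite ger0_norm ?subr_ge0 ?exprn_ile1 // ?(ltW delta_gt0) //.
      by rewrite ltrBlDr ltrDl exprn_gt0.
    rewrite leNgt; apply/negP => e0.
    have /cvgrPdist_lt/(_ _ e0) [k _ /(_ k (leqnn k))] := cvg_expr rho.
    rewrite /= sub0r normrN => /(le_lt_trans (ler_norm _)).
    by apply/negP; rewrite -leNgt -lee_fin -prE.
  move=> h1; rewrite prE //; congr (_%:E); apply/eqP.
  by rewrite eq_le h1 pr_ge0.
have : P.-negligible (\bigcup_l bad l).
  apply: negligible_bigcup => l; exists (bad l).
  by split; [exact: bigcapT_measurable | exact: bad0 |].
move=> [N [mN N0 badN]]; exists N; split=> // w /= /existsNP[l Hl].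
apply: badN; exists l => // k _.
have Hk i : exists m, ~ window_event m (l + i) w.
  apply/existsNP => h1; apply: Hl; exists (l + i)%N => //; exact: leq_addr.
have [f Hf] := choice Hk.
(* A window that fails on some grid fails on all finer ones, so the largest of the [k] levels serves
   for all. *)
exists (\max_(i < k) f i)%N => //; apply/missed_eventP => i ik.
apply: contra_not (Hf i); apply: window_event_antitone.
exact: (leq_bigmax (Ordinal ik)).
Qed.

End Window.
End MarkovWindows.

(** * Independent families of Markov chains *)

(** The witness is below every [f x] since its inverse exceeds [1 / f x]; the added [1] keeps it
    positive for an empty [T]. *)
Lemma fin_lower_bound (R : realFieldType) (T : finType) (f : T -> R) :
  (forall x, 0 < f x) -> exists2 e, 0 < e & forall x, e <= f x.
Proof.
move=> f0; have s0 : 0 <= \sum_x (f x)^-1.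
  by apply: sumr_ge0 => x _; rewrite invr_ge0 ltW.
exists (1 + \sum_x (f x)^-1)^-1; first by rewrite invr_gt0; lra.
move=> x; rewrite -[leRHS]invrK lef_pV2 ?posrE ?invr_gt0 //; last by lra.
rewrite (bigD1 x) //= addrCA lerDl addr_ge0 // sumr_ge0 // => y _.
by rewrite invr_ge0 ltW.
Qed.

Section JumpRates.
Variables (R : realType) (S : finType) (p : R -> S -> S -> R) (q : S -> S -> R).
Hypothesis p_trans : transition_function p.
Hypothesis p_rates : has_jump_rates p q.

Lemma transition_le_comp (s t : R) x y z : 0 <= s -> 0 <= t ->
  p s x y * p t y z <= p (s + t) x z.
Proof.
case: p_trans => p0 _ _ ck s0 t0.
rewrite ck // (bigD1 y) //= lerDl sumr_ge0 // => u _.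
by rewrite mulr_ge0 ?p0.
Qed.

(** Rows sum to one, and off the diagonal [p t x y] is at most [(|q x y| + 1) * t] for small [t] by
    definition of the rates. Finiteness of [S] makes [C] and [t0] uniform. *)
Lemma transition_diag_ge : exists2 C, 0 <= C & exists2 t0 : R, 0 < t0 &
  forall x t, 0 <= t -> t < t0 -> 1 - C * t <= p t x x.
Proof.
case: p_trans => p0 p1 pid _.
have H (e : S * S) : exists r : R, 0 < r /\ forall t : R, 0 < t -> t < r ->
    e.1 != e.2 -> p t e.1 e.2 <= (`|q e.1 e.2| + 1) * t.
  have [e12|e12] := eqVneq e.1 e.2; first by exists 1; split.
  have /cvgrPdist_lt/(_ _ ltr01) := p_rates e12.
  move=> [r /= r0 Hr]; exists r; split=> // t t0 tr _.
  have := Hr t; rewrite /ball_ /= sub0r normrN gtr0_norm // => /(_ tr t0).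
  rewrite distrC => h; rewrite -ler_pdivrMr //.
  have := ler_norm (q e.1 e.2); move: h; rewrite ltr_norml => /andP[_ h]; lra.
have [r Hr] := choice H.
have [t0 t0_gt0 t0r] := fin_lower_bound (fun e => proj1 (Hr e)).
exists (\sum_x \sum_y (`|q x y| + 1)).
  by apply: sumr_ge0 => x _; apply: sumr_ge0 => y _; rewrite addr_ge0.
exists t0 => // x t; rewrite le_eqVlt => /predU1P[<- _|tgt0 tt0].
  by rewrite mulr0 subr0 pid eqxx.
rewrite -[X in X - _](p1 t x (ltW tgt0)) (bigD1 x) //= lerBlDr lerD2l mulr_suml.
rewrite [leRHS](bigD1 x) //= mulr_suml -[leLHS]addr0 lerD //; last first.
  apply: sumr_ge0 => y _; apply: mulr_ge0; last exact: ltW.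
  by apply: sumr_ge0 => z _; rewrite addr_ge0.
rewrite [leRHS](bigD1 x) //= -[leLHS]add0r lerD //.
  by apply: mulr_ge0; [rewrite addr_ge0 | exact: ltW].
apply: ler_sum => y yx; have [_ h] := Hr (x, y).
by apply: h => //=; [apply: lt_le_trans tt0 (t0r (x, y)) | rewrite eq_sym].
Qed.

Lemma transition_diag_exp (t : R) x n : 0 <= t -> p t x x ^+ n <= p (n%:R * t) x x.
Proof.
case: (p_trans) => p0 _ pid _ t0; elim: n => [|n IH].
  by rewrite mul0r pid eqxx.
rewrite -natr1 mulrDl mul1r exprSr; apply: le_trans (transition_le_comp _ x _ _ _) => //.
  by rewrite ler_wpM2r // p0.
by rewrite mulr_ge0.
Qed.

(** Staying put has positive probability over any time, by cutting it into short pieces. An edge is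
    crossed during some short time [s], followed by staying; a path is handled by giving its first
    edge half of the time. *)
Lemma transition_gt0 x y : connect (fun u v => 0 < q u v) x y ->
  forall t : R, 0 < t -> 0 < p t x y.
Proof.
case: (p_trans) => p0 _ _ _.
have [C C0 [t0 t0_gt0 HC]] := transition_diag_ge.
have small (t : R) : 0 < t -> exists n : nat, t / n.+1%:R < (C + 1)^-1 /\ t / n.+1%:R < t0.
  move=> tgt0; exists (Num.truncn (t * (C + 1) + t / t0)).
  have := truncnS_gt (t * (C + 1) + t / t0); set n := (_.+1)%:R => hn.
  have a0 : 0 <= t * (C + 1) by rewrite mulr_ge0 ?(ltW tgt0) //; lra.
  have b0 : 0 <= t / t0 by rewrite divr_ge0 // ltW.
  have n0 : 0 < n by lra.
  split; rewrite ltr_pdivrMr // mulrC.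
    by rewrite ltr_pdivlMr; lra.
  by rewrite -ltr_pdivrMr //; lra.
have diag z (t : R) : 0 < t -> 0 < p t z z.
  move=> tgt0; have [n [h1 h2]] := small t tgt0.
  have tn : 0 <= t / n.+1%:R by rewrite divr_ge0 // ltW.
  have h3 := HC z _ tn h2.
  have : 0 < p (t / n.+1%:R) z z.
    apply: lt_le_trans h3; rewrite subr_gt0.
    move: h1 tn; set u := t / _; rewrite -[X in _ < X]mul1r ltr_pdivlMr; lra.
  move=> h4; have := transition_diag_exp z n.+1 tn.
  rewrite [n.+1%:R * _]mulrC divfK ?pnatr_eq0 //; apply: lt_le_trans.
  by rewrite exprn_gt0.
have edge u v (t : R) : u != v -> 0 < q u v -> 0 < t -> 0 < p t u v.
  move=> uv quv tgt0.
  have /cvgrPdist_lt/(_ _ quv) [r /= r0 Hr] := p_rates uv.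
  pose s := Num.min (r / 2) (t / 2).
  have s0 : 0 < s by rewrite lt_min !divr_gt0.
  have sr : s < r.
    by apply: (@le_lt_trans _ _ (r / 2)); [rewrite ge_min lexx | lra].
  have st : s < t.
    by apply: (@le_lt_trans _ _ (t / 2)); [rewrite ge_min lexx orbT | lra].
  have := Hr s; rewrite /ball_ /= sub0r normrN gtr0_norm // => /(_ sr s0).
  rewrite ltr_norml => /andP[_ h].
  have h1 : 0 < p s u v.
    have h2 : 0 < p s u v / s by lra.
    by have := mulr_gt0 h2 s0; rewrite divfK // gt_eqF.
  have st0 : 0 <= t - s by lra.
  have := @transition_le_comp s (t - s) u v v (ltW s0) st0.
  rewrite [s + _]addrC subrK; apply: lt_le_trans.
  by rewrite mulr_gt0 // diag // subr_gt0.
move=> /connectP[l]; elim: l x => [|v l IH] x /=; first by move=> _ -> t; exact: diag.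
move=> /andP[qxv pv] yl t tgt0.
have t2 : 0 < t / 2 by rewrite divr_gt0.
rewrite [t]splitr; apply: lt_le_trans (@transition_le_comp _ _ x v y (ltW t2) (ltW t2)).
apply: mulr_gt0; last exact: IH.
(* A loop in the path carries no information on the rates and is treated as staying. *)
have [<-|xv] := eqVneq x v; first exact: diag.
exact: edge.
Qed.

End JumpRates.

(** * The product of independent chains *)

Section JointProcess.
Variables (R : realType) (d : measure_display) (Omega : measurableType d).
Variables (P : probability Omega R) (I S : finType) (X : I -> R -> Omega -> S)
  (p : I -> R -> S -> S -> R).
Hypothesis X_measurable :
  forall i (t : R) x, 0 <= t -> measurable [set w | X i t w = x].
Hypothesis X_markov : forall i, markov_property P (X i) (p i).
Hypothesis X_indep : independent_processes P X.

Definition joint_process (t : R) (w : Omega) : {ffun I -> S} :=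
  [ffun i => X i t w].

Definition joint_kernel (t : R) (x y : {ffun I -> S}) : R :=
  \prod_i p i t (x i) (y i).

Lemma joint_process_eqE t x :
  [set w | joint_process t w = x] = \bigcap_i [set w | X i t w = x i].
Proof.
apply/seteqP; split=> w /=; first by move=> <- i _ /=; rewrite ffunE.
by move=> H; apply/ffunP => i; rewrite ffunE; exact: H.
Qed.

Lemma joint_process_measurable (t : R) x : 0 <= t ->
  measurable [set w | joint_process t w = x].
Proof.
move=> t0; rewrite joint_process_eqE.
by apply: fin_bigcap_measurable => // i _; exact: X_measurable.
Qed.

(** Measurability of cylinders is applied with the sigma-algebra generated by [X i] in place of the
    one of [Omega]. *)
Lemma process_sigma_algebra_past i (past : seq (R * S)) :
  (forall r, r \in past -> 0 <= r.1) ->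
  process_sigma_algebra (X i) [set w | forall r, r \in past -> X i r.1 w = r.2].
Proof.
move=> h.
apply: (@measurable_past_event _ _ (g_sigma_algebraType
  [set A | exists t x, 0 <= t /\ A = [set w | X i t w = x]]) S (X i)) => // t x t0.
by apply: sub_sigma_algebra; exists t, x.
Qed.

(** Every event involved is an intersection over [i] of events of the [i]-th chain. Independence
    turns both sides into products, which agree factor by factor. *)
Lemma joint_process_markov : markov_property P joint_process joint_kernel.
Proof.
move=> past t h x y t0 h0 hp /=.
pose past' i := [seq (r.1, r.2 i) | r : R * {ffun I -> S} <- past].
pose B i := [set w | forall r, r \in past' i -> X i r.1 w = r.2] `&`
   [set w | X i t w = x i].
pose A i := B i `&` [set w | X i (t + h) w = y i].
have pastE : [set w | forall r, r \in past -> joint_process r.1 w = r.2] =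
    \bigcap_i [set w | forall r, r \in past' i -> X i r.1 w = r.2].
  apply/seteqP; split=> w /=.
    by move=> H i _ r /mapP[r' rp ->] /=; rewrite -(H _ rp) ffunE.
  move=> H r rp; apply/ffunP => i; rewrite ffunE.
  by apply: (H i _ (r.1, r.2 i)) => //; apply: map_f.
have past'P i (r : R * S) : r \in past' i -> 0 <= r.1 <= t.
  by move=> /mapP[r' /hp rp ->].
have th0 : 0 <= t + h by rewrite addr_ge0.
have sigmaI i (U V : set Omega) : process_sigma_algebra (X i) U ->
    process_sigma_algebra (X i) V -> process_sigma_algebra (X i) (U `&` V).
  exact: (@measurableI _ (g_sigma_algebraType
  [set A | exists t x, 0 <= t /\ A = [set w | X i t w = x]])).
have sB i : process_sigma_algebra (X i) (B i).
  apply: sigmaI.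
    by apply: (@process_sigma_algebra_past i (past' i)) => r rp; have /andP[] := past'P _ _ rp.
  by apply: sub_sigma_algebra; exists t, (x i).
have sA i : process_sigma_algebra (X i) (A i).
  by apply: sigmaI => //; apply: sub_sigma_algebra; exists (t + h), (y i).
rewrite pastE !joint_process_eqE -!bigcapI.
have mB i : measurable (B i).
  apply: measurableI; last exact: X_measurable.
  by apply: measurable_past_event => [u v u0|r rp]; [exact: X_measurable | have /andP[] := past'P _ _ rp].
rewrite (X_indep sA) (X_indep sB) /joint_kernel.
rewrite (eq_bigr (fun i => (fine (P (B i)) * p i h (x i) (y i))%:E)).
  rewrite [X in _ = (X * _)%E](eq_bigr (fun i => (fine (P (B i)))%:E)).
    by rewrite !prodEFin big_split.
  by move=> i _; rewrite fineK // fin_num_measure.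
move=> i _; rewrite EFinM fineK ?fin_num_measure //.
exact: (@X_markov i (past' i) t h (x i) (y i) t0 h0 (past'P i)).
Qed.

End JointProcess.

(** Grid points approach [t] from the right, where [f] is locally equal to [f t]. *)
Lemma cadlag_path_grid (R : realType) (S : finType) (f : R -> S) (s h : R) z :
  cadlag_path f -> 0 <= s -> 0 < h ->
  (forall m j, (j <= 2 ^ m)%N -> f (s + j%:R * (h / (2 ^ m)%:R)) = z) ->
  forall t, s <= t < s + h -> f t = z.
Proof.
move=> [rc _] s0 h0 H t /andP[st tsh].
have [r /= r0 Hr] := rc t (le_trans s0 st).
(* A grid point within [e] to the right of [t] is both in the neighbourhood of right-continuity and
   not beyond [s + h]. *)
pose e := Num.min r (s + h - t).
have e0 : 0 < e by rewrite lt_min r0 subr_gt0.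
pose m := Num.truncn (h / e).
have hm : h / (2 ^ m)%:R < e.
  rewrite ltr_pdivrMr ?ltr0n ?expn_gt0 // -ltr_pdivrMl // mulrC.
  apply: lt_le_trans (truncnS_gt _) _; rewrite ler_nat; exact: ltn_expl.
set eta := h / _ in hm.
have eta0 : 0 < eta by rewrite divr_gt0 // ltr0n expn_gt0.
pose j := (Num.truncn ((t - s) / eta)).+1.
have ts0 : 0 <= (t - s) / eta by rewrite divr_ge0 ?subr_ge0 // ltW.
have /andP[j1 j2] := truncn_itv ts0.
have j1' : j%:R * eta <= t - s + eta.
  by rewrite -natr1 mulrDl mul1r lerD2r -ler_pdivlMr.
have j2' : t - s < j%:R * eta by rewrite -ltr_pdivrMr.
have er : e <= r by rewrite ge_min lexx.
have esh : e <= s + h - t by rewrite ge_min lexx orbT.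
rewrite -(H m j); last first.
  rewrite -(ler_nat R) -(ler_pM2r eta0) [X in _ <= X](_ : _ = h).
    by lra.
  by rewrite /eta mulrC divfK // pnatr_eq0 expn_eq0.
symmetry; apply: Hr; rewrite /= -?/eta; last by lra.
by rewrite /ball_ /= distrC ger0_norm; lra.
Qed.

Lemma bernoulli_le (R : realFieldType) (x : R) n : 0 <= x -> x <= 1 ->
  1 - n%:R * x <= (1 - x) ^+ n.
Proof.
move=> x0 x1; elim: n => [|n IH]; first by rewrite mul0r subr0.
have x1' : 0 <= 1 - x by lra.
rewrite exprS; apply: le_trans (ler_wpM2l x1' IH).
have h : 0 <= n%:R * x ^+ 2 by rewrite mulr_ge0 // sqr_ge0.
rewrite -natr1; lra.
Qed.

Section Recurrence.
Variables (R : realType) (d : measure_display) (Omega : measurableType d).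
Variables (P : probability Omega R) (I S : finType) (X : I -> R -> Omega -> S)
  (q : S -> S -> R) (x0 z : I -> S).
Hypothesis X_chain : forall i, markov_chain P q (x0 i) (X i).
Hypothesis X_indep : independent_processes P X.
Hypothesis z_reachable : forall i x, connect (fun u v => 0 < q u v) x (z i).

Lemma markov_chains_recurrent : exists2 h : R, 0 < h &
  {ae P, forall w, forall l : R, exists s, [/\ 0 <= s, l <= s &
    forall t, s <= t < s + h -> forall i, X i t w = z i]}.
Proof.
have [p Hp] := choice (fun i => let: And4 _ _ _ H := X_chain i in H).
have X_meas i (t : R) x : 0 <= t -> measurable [set w | X i t w = x].
  by case: (X_chain i) => H _ _ _; exact: H.
have pT i : transition_function (p i) by case: (Hp i).
have pR i : has_jump_rates (p i) q by case: (Hp i).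
have pM i : markov_property P (X i) (p i) by case: (Hp i).
have diag i : exists r : R, 0 < r /\ forall h, 0 < h -> h <= r -> forall m,
    1 / 2 <= p i (h / (2 ^ m)%:R) (z i) (z i) ^+ (2 ^ m).
  have [C C0 [t0 t0_gt0 HC]] := transition_diag_ge (pT i) (pR i).
  (* For [h <= r] the diagonal estimate applies and [C * h <= 1 / 2]; by Bernoulli's inequality the
     [2 ^ m] grid steps then cost at most [C * h] in total, whatever [m]. *)
  pose r := Num.min (t0 / 2) ((2 * (C + 1))^-1).
  exists r; split; first by rewrite lt_min divr_gt0 // invr_gt0; lra.
  move=> h h0 hr m.
  have ht : h <= t0 / 2 by apply: le_trans hr _; rewrite ge_min lexx.
  have hC : C * h <= 1 / 2.
    have : h <= (2 * (C + 1))^-1 by apply: le_trans hr _; rewrite ge_min lexx orbT.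
    rewrite -[X in _ <= X]mul1r ler_pdivlMr; lra.
  have n0 : (0 : R) < (2 ^ m)%:R by rewrite ltr0n expn_gt0.
  have n1 : (1 : R) <= (2 ^ m)%:R by rewrite ler1n expn_gt0.
  set eta := h / _.
  have eta0 : 0 <= eta by rewrite divr_ge0 // ltW.
  have eta_h : eta <= h by rewrite ler_pdivrMr // ler_peMr // ltW.
  have Ceta : C * eta <= 1 / 2 by apply: le_trans (ler_wpM2l C0 eta_h) hC.
  have Ceta0 : 0 <= C * eta by rewrite mulr_ge0.
  have nE : (2 ^ m)%:R * (C * eta) = C * h.
    by rewrite mulrCA /eta [_%:R * _]mulrC divfK // gt_eqF.
  have h1 := HC (z i) eta eta0 ltac:(lra).
  apply: (@le_trans _ _ (1 - (2 ^ m)%:R * (C * eta))); first by rewrite nE; lra.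
  apply: le_trans (@bernoulli_le R (C * eta) (2 ^ m) Ceta0 ltac:(lra)) _.
  by rewrite lerXn2r // nnegrE; lra.
have [r Hr] := choice diag.
have [h h0 hr] := fin_lower_bound (fun i => proj1 (Hr i)).
pose zf : {ffun I -> S} := [ffun i => z i].
have hit_gt0 (x : {ffun I -> S}) : 0 < joint_kernel p h x zf.
  apply: prodr_gt0 => i _; apply: (transition_gt0 (pT i) (pR i)) => //.
  by rewrite ffunE; exact: z_reachable.
have [d1 d1_gt0 Hd1] := fin_lower_bound hit_gt0.
pose d2 : R := \prod_(i : I) (1 / 2).
have d2_gt0 : 0 < d2 by apply: prodr_gt0 => i _; rewrite divr_gt0.
pose delta := Num.min d1 (Num.min d2 1).
have delta_gt0 : 0 < delta by rewrite !lt_min d1_gt0 d2_gt0 ltr01.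
have delta_le1 : delta <= 1 by rewrite !ge_min lexx !orbT.
have hit_ge x : delta <= joint_kernel p h x zf.
  by apply: le_trans (Hd1 x); rewrite ge_min lexx.
have stay_ge m : delta <= joint_kernel p (h / (2 ^ m)%:R) zf zf ^+ (2 ^ m).
  apply: (@le_trans _ _ d2); first by rewrite !ge_min lexx orbT.
  rewrite -prodrXl; apply: ler_prod => i _; rewrite ffunE divr_ge0 //=.
  by case: (Hr i) => _; exact.
have rec := recurrent_windows (joint_process_measurable X_meas)
  (joint_process_markov X_meas pM X_indep) h0 delta_gt0 delta_le1 hit_ge stay_ge.
exists h => //; apply: ae_imp rec => w Hw l.
have [k lk Hk] := Hw (Num.truncn (l / (2 * h))).+1.
have k0 : 0 <= k%:R * (2 * h) by rewrite mulr_ge0 // mulr_ge0 // ltW.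
exists (k%:R * (2 * h) + h); split; first by rewrite addr_ge0 // ltW.
  apply: (@le_trans _ _ (k%:R * (2 * h))); last by rewrite lerDl ltW.
  rewrite -ler_pdivrMr; last by rewrite mulr_gt0.
  by apply: le_trans (ltW (truncnS_gt _)) _; rewrite ler_nat.
move=> t ht i; have [_ Hcad _ _] := X_chain i.
apply: (cadlag_path_grid (Hcad w) _ h0 _ ht); first by rewrite addr_ge0 // ltW.
by move=> m j jm; have := Hk m j jm => /ffunP/(_ i); rewrite !ffunE.
Qed.

End Recurrence.

(** * Phases on the circle *)

Section Circle.
Variable R : realType.
Implicit Types (a b : R) (x y : circle R).

Lemma to_circle_surj x : exists a : R, to_circle a = x.
Proof. by exists (repr x); rewrite /to_circle reprK. Qed.

Lemma geodist_set_ge0 x y : lbound [set r | exists a b : R,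
    [/\ to_circle a = x, to_circle b = y & r = `|a - b|]] 0.
Proof. by move=> _ [a [b [_ _ ->]]]. Qed.

Lemma geodist_le a b : geodist (to_circle a) (to_circle b) <= `|a - b|.
Proof.
by apply: ge_inf; [exists 0; exact: geodist_set_ge0 | exists a, b].
Qed.

Lemma geodist_ge0 x y : 0 <= geodist x y.
Proof.
apply: lb_le_inf; last exact: geodist_set_ge0.
have [a ax] := to_circle_surj x; have [b b_y] := to_circle_surj y.
by exists `|a - b|, a, b.
Qed.

Lemma geodist_lt_lift x y (r : R) : geodist x y < r ->
  exists a b, [/\ to_circle a = x, to_circle b = y & `|a - b| < r].
Proof.
move=> /inf_lt[|_ [a [b [ax b_y ->]]] lt_r]; last by exists a, b.
by have [a ax] := to_circle_surj x; have [b b_y] := to_circle_surj y; exists `|a - b|, a, b.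
Qed.

Lemma sinD2pi_int (u : R) (k : int) : sin (u + k%:~R * (2 * pi)) = sin u.
Proof.
have -> : 2 * pi = pi *+ 2 :> R by rewrite mulr_natl.
have per := periodicn (@sinD2pi R).
case: k => n; first by rewrite -pmulrn [_%:R * _]mulr_natl per.
by rewrite NegzE mulrNz mulNr -pmulrn [_%:R * _]mulr_natl -(per n.+1) subrK.
Qed.

End Circle.

(** The lifts are shifted by multiples of [2 * pi] until, at time [0], they all lie close to the
    lift of one chosen phase [i0]. The field is periodic, so the shifted lifts solve the same system
    on the line. *)
Lemma kuramoto_circle_sync (R : realType) (I : finType) (K : R)
    (a : R -> I -> I -> R) (theta : R -> I -> circle R) (gamma A h : R)
    (b : I -> I -> R) :
  0 < K -> gamma < pi / 2 ->
  (forall t i j, a t i j = a t j i) -> (forall t i j, 0 <= a t i j) ->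
  (forall t i j, a t i j <= A) ->
  phase_cohesive gamma (theta 0) ->
  kuramoto_solution K (fun=> 0) a theta ->
  (forall i j, connect (fun u v => 0 < b u v) i j) -> 0 < h ->
  (forall l, exists s, [/\ 0 <= s, l <= s & forall t, s <= t < s + h -> a t = b]) ->
  converges_up_to_translation theta.
Proof.
move=> K0 gpi asym a0 aA coh [phi [lift phi_ac phi_d]] conn h0 win.
have [i0 _|noI] := pickP (@predT I); last first.
  by exists (to_circle 0) => i; have := noI i.
have pi0 := pi_gt0 R.
(* The geodesic distance is an infimum, so lifts are found only at distances strictly above [gamma];
   the midpoint with [pi / 2] leaves that room. *)
pose r := Num.max 0 ((gamma + pi / 2) / 2).
have r0 : 0 <= r by rewrite le_max lexx.
have rpi : r < pi / 2 by rewrite gt_max; apply/andP; split; lra.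
have gr : gamma < r by rewrite lt_max; apply/orP; right; lra.
have Hk i : exists k : int, `|phi 0 i - k%:~R * (2 * pi) - phi 0 i0| < r.
  have [x [y [xi yi0 xy]]] := geodist_lt_lift (le_lt_trans (coh i i0) gr).
  have /to_circleP[k Ek] : to_circle (phi 0 i) = to_circle x by rewrite lift // xi.
  have /to_circleP[k' Ek'] : to_circle (phi 0 i0) = to_circle y by rewrite lift // yi0.
  exists (k - k'); rewrite Ek Ek' intrB.
  by rewrite (_ : _ - _ = x - y) //; ring.
have [k0 Hk0] := choice Hk.
pose psi t i := phi t i - (k0 i)%:~R * (2 * pi).
have psi_ac (T : R) i : 0 < T -> absolutely_continuous_on 0 T (psi ^~ i : R -> R).
  move=> T0 e e0; have [dd dd0 Hd] := phi_ac T i T0 e e0.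
  exists dd => // l h1 h2 h3; have := Hd l h1 h2 h3; congr (_ < e).
  by apply: eq_bigr => p _; rewrite /psi opprB addrA subrK.
have psi_d : {ae (@lebesgue_measure R), forall t : R, (0 : R) < t -> forall i,
  is_derive t (1 : R) (psi ^~ i : R -> R)
    (kuramoto_field K (fun=> 0) (a t) (psi t) i)}.
  apply: ae_imp phi_d => t ht t0 i; have := ht t0 i.
  have -> : kuramoto_field K (fun=> 0) (a t) (psi t) i =
            kuramoto_field K (fun=> 0) (a t) (phi t) i.
    congr (_ + _ * _); apply: eq_bigr => j _; congr (_ * _).
    rewrite -[RHS](sinD2pi_int _ (k0 i - k0 j)); congr sin.
    by rewrite /psi intrB; ring.
  move=> hd; have := is_deriveD hd (is_derive_cst (- ((k0 i)%:~R * (2 * pi))) t 1).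
  by rewrite addr0.
have [l Hl] := kuramoto_sync K0 asym a0 aA psi_ac psi_d r0 rpi
  (fun i => ltW (Hk0 i)) conn h0 win.
exists (to_circle l) => i; apply/cvgrPdist_lt => e e0.
have /cvgrPdist_lt/(_ _ e0) psi_l := Hl i.
near=> t; rewrite sub0r normrN ger0_norm ?geodist_ge0 //.
have t0 : 0 <= t by near: t; apply: nbhs_pinfty_ge; rewrite num_real.
have -> : theta t i = to_circle (psi t i).
  rewrite -lift //; apply/to_circleP; exists (k0 i).
  by rewrite /psi subrK.
apply: le_lt_trans (geodist_le _ _) _; rewrite distrC.
by near: t.
Unshelve. all: by end_near.
Qed.

Theorem theorem1p5 (R : realType) (V : finType) (G : weighted_graph R V)
    (K : R) (K_gt0 : 0 < K) (N : nat) (N_ge2 : (2 <= N)%N)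
    (gamma : R) (gamma_gt0 : 0 < gamma) (gamma_lt : gamma < pi / 2)
    (d : measure_display) (Omega : measurableType d)
    (P : probability Omega R) :
  ((forall u, 0 < G u u) ->
   forall (eps : R) (x0 : 'I_N -> V) (X : 'I_N -> R -> Omega -> V)
     (theta0 : 'I_N -> circle R) (theta : Omega -> R -> 'I_N -> circle R),
     0 < eps ->
     (forall i, markov_chain P (walk_rate G eps) (x0 i) (X i)) ->
     independent_processes P X ->
     phase_cohesive gamma theta0 ->
     (forall w, theta w 0 = theta0) ->
     (forall w, kuramoto_solution K (fun=> 0)
        (fun t => walk_coupling G (fun i => X i t w)) (theta w)) ->
     {ae P, forall w, converges_up_to_translation (theta w)})
  /\
  (forall (eps kappa : R) (Y : edge G -> R -> Omega -> bool)
     (theta0 : V -> circle R) (theta : Omega -> R -> V -> circle R),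
     0 < eps -> 0 < kappa ->
     (forall e, markov_chain P (conductance_rate eps kappa) true (Y e)) ->
     independent_processes P Y ->
     phase_cohesive gamma theta0 ->
     (forall w, theta w 0 = theta0) ->
     (forall w, kuramoto_solution K (fun=> 0)
        (fun t => edge_coupling G (open_edges (fun e => Y e t w)))
        (theta w)) ->
     {ae P, forall w, converges_up_to_translation (theta w)}).
Proof.
have [A HA] : exists A, forall u v, G u v <= A.
  exists (\sum_u \sum_v G u v) => u v.
  rewrite (bigD1 u) //= (bigD1 v) //= -addrA lerDl addr_ge0 //.
    by apply: sumr_ge0 => j _; exact: weight_ge0.
  by apply: sumr_ge0 => i _; apply: sumr_ge0 => j _; exact: weight_ge0.
split.
  move=> loops eps x0 X theta0 theta eps0 chains indep coh init sol.
  pose u0 := x0 (Ordinal (ltnW N_ge2)).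
  have reach (i : 'I_N) x : connect (fun u v => 0 < walk_rate G eps u v) x u0.
    apply: connect_sub (weight_connected G x u0) => u v Guv; apply: connect1.
    by rewrite /walk_rate mulr_gt0 ?invr_gt0 // divr_gt0 // weight_sum_gt0.
  have [h h0 rec] := markov_chains_recurrent (z := fun=> u0) chains indep reach.
  apply: ae_imp rec => w Hw.
  (* With all walkers at [u0] every pair is coupled with the weight of the self-loop, which is
     positive: a complete graph. *)
  apply: (@kuramoto_circle_sync _ _ K _ _ gamma A h (fun _ _ => G u0 u0) _ _ _ _ _ _ (sol w)) => //.
  - by move=> t i j; exact: weight_sym.
  - by move=> t i j; exact: weight_ge0.
  - by move=> t i j; exact: HA.
  - by rewrite init.
  - by move=> i j; apply: connect1.
  move=> l; have [s [s0 ls Hs]] := Hw l; exists s; split=> // t ht.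
  by apply/funext => i; apply/funext => j; rewrite /walk_coupling !Hs.
move=> eps kappa Y theta0 theta eps0 kappa0 chains indep coh init sol.
have reach (e : edge G) x :
    connect (fun u v => 0 < conductance_rate eps kappa u v) x true.
  by apply: connect1; case: x => //=; rewrite invr_gt0.
have [h h0 rec] := markov_chains_recurrent (z := fun=> true) chains indep reach.
apply: ae_imp rec => w Hw.
apply: (@kuramoto_circle_sync _ _ K _ _ gamma A h G _ _ _ _ _ _ (sol w)) => //.
- by move=> t i j; rewrite /edge_coupling finset.setUC weight_sym.
- by move=> t i j; rewrite /edge_coupling; case: ifP => // _; exact: weight_ge0.
- move=> t i j; rewrite /edge_coupling; case: ifP => // _.
  exact: le_trans (weight_ge0 G i j) (HA i j).
- by rewrite init.
- by move=> i j; exact: weight_connected.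
move=> l; have [s [s0 ls Hs]] := Hw l; exists s; split=> // t ht.
apply/funext => u; apply/funext => v; rewrite /edge_coupling.
(* With all edges open the coupling is [G] itself: a pair that is not open is no edge, so its weight
   is [0]. *)
case: ifPn => // uvE; apply/eqP; rewrite eq_le weight_ge0 leNgt.
apply: contra uvE => Guv.
have uv_edge : [set u; v]%SET \in edges G.
  by rewrite inE; apply/existsP; exists u; apply/existsP; exists v; rewrite eqxx.
apply/imsetP; exists (exist (fun e => e \in edges G) _ uv_edge) => //.
by rewrite inE; exact: Hs.
Qed.
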